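(* There is a deterministic algorithm in the Congested Clique model that solves the Minimum Spanning Tree problem (equivalently, the Minimum Spanning Forest problem) on an arbitrary $n$-vertex weighted input graph $G$ with $m$ edges in $\mathcal{O}(1)$ rounds, using $\mathcal{O}(m)$ communication.
   Context: Congested Clique model: there are $n$ players (processors), each corresponding to one vertex of an $n$-vertex input graph $G$; initially each player knows the edges (with their weights) incident to its vertex. Computation proceeds in synchronous rounds; in each round every player performs arbitrary local computation, and then every pair of players can exchange one message of $\mathcal{O}(\log n)$ bits in each direction. Minimum Spanning Tree/Forest problem: given a weighted graph, compute a minimum-weight acyclic set of edges that spans every connected component of the graph (a minimum spanning tree of each component); at the end the output edges must be known by the players (e.g. by some player). Communication is measured as the number of messages sent, where messages delivered via Lenzen's deterministic $\mathcal{O}(1)$-round routing protocol (which delivers any set of messages in which every player is the source and destination of $\mathcal{O}(n)$ messages) are counted as the messages themselves, without the overhead of the routing protocol; ''using $\mathcal{O}(m)$ communication'' means that in each round each player sends and receives $\mathcal{O}(n)$ messages and the total number of messages is $\mathcal{O}(m)$.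
   Formalization: The edge weights are taken to be integers of absolute value at most n^c for an arbitrary fixed c, with the constants depending on c; for unbounded weights the claim fails, since O(1) rounds of O(log n)-bit messages cannot compare two opposite edges of a 4-cycle. *)

(* Defs.v *)
From mathcomp Require Import all_boot all_order all_algebra.

Set Implicit Arguments.
Unset Strict Implicit.
Unset Printing Implicit Defensive.

Import Order.TTheory GRing.Theory Num.Theory.

(** * Weighted graphs and minimum spanning forests *)

(* Simple graphs on the vertex set 'I_n; [None] means "no edge". *)
Record wgraph (n : nat) := WGraph {
  wt :> 'I_n -> 'I_n -> option int;
  wt_sym : forall u v, wt u v = wt v u;
  wt_irr : forall v, wt v v = None }.

(* The undirected edge {u, v} with u < v is represented by the pair (u, v). *)
Definition edge_set n := {set 'I_n * 'I_n}.

Definition edges n (G : wgraph n) : edge_set n :=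
  [set e : 'I_n * 'I_n | (e.1 < e.2)%N && isSome (G e.1 e.2)].

Definition weight n (G : wgraph n) (F : edge_set n) : int :=
  (\sum_(e in F) odflt 0 (G e.1 e.2))%R.

Definition adj n (F : edge_set n) : rel 'I_n :=
  [rel u v | ((u, v) \in F) || ((v, u) \in F)].

(* [ucycle] also accepts the back-and-forth walk [:: u; v] along one edge,
   hence the restriction to at least three vertices. *)
Definition acyclic n (F : edge_set n) : Prop :=
  forall s : seq 'I_n, 2 < size s -> ~ ucycle (adj F) s.

Definition spanning_forest n (G : wgraph n) (F : edge_set n) : Prop :=
  [/\ F \subset edges G, acyclic F
    & forall u v, connect (adj F) u v = connect (adj (edges G)) u v].

Definition minimum_spanning_forest n (G : wgraph n) (F : edge_set n) : Prop :=
  spanning_forest G F /\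
  forall F', spanning_forest G F' -> (weight G F <= weight G F')%R.

(* Weights are integers of O(log n) bits, so that a weight fits in O(1)
   messages. *)
Definition poly_weights (c n : nat) (G : wgraph n) : Prop :=
  forall u v w, G u v = Some w -> (`|w| <= (n ^ c)%:Z)%R.

(** * Synchronous deterministic message passing among n players *)

Definition message := seq bool.

(* A player is started with its identifier and its own row of the weight
   matrix only, and local computation is unrestricted: [init], [send],
   [recv] and [output] are arbitrary functions. [send s v] lists the messages
   sent to player [v] from local state [s]; in [recv s inbox], [inbox u] lists
   the messages received from player [u]. *)
Record protocol (n : nat) := Protocol {
  state : Type;
  init : 'I_n -> ('I_n -> option int) -> state;
  send : state -> 'I_n -> seq message;
  recv : state -> ('I_n -> seq message) -> state;
  output : state -> edge_set n }.

Section Execution.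

Variables (n : nat) (P : protocol n) (G : wgraph n).

(* The state of a player after [t] rounds. *)
Fixpoint run (t : nat) : 'I_n -> state P :=
  if t is t'.+1 then
    fun v => recv (run t' v) (fun u => send (run t' u) v)
  else fun v => init P v (G v).

Definition sent (t : nat) (u v : 'I_n) : seq message := send (run t u) v.

Definition outgoing (t : nat) (u : 'I_n) : nat := \sum_v size (sent t u v).
Definition incoming (t : nat) (v : 'I_n) : nat := \sum_u size (sent t u v).

Definition communication (T : nat) : nat := \sum_(t < T) \sum_u outgoing t u.

(* [up_log 2 n] is the ceiling of the base 2 logarithm of [n]. *)
Definition log_messages (K T : nat) : Prop :=
  forall t u v msg, t < T -> msg \in sent t u v -> size msg <= K * up_log 2 n.

Definition congested_clique (K T : nat) : Prop :=
  log_messages K T /\ forall t u v, t < T -> size (sent t u v) <= 1.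

(* Rounds executed by a routing protocol, which may carry several messages
   between the same two players, provided that every player is the source and
   the destination of O(n) messages. *)
Definition routed (K T : nat) : Prop :=
  log_messages K T /\
  forall t v, t < T -> outgoing t v <= K * n /\ incoming t v <= K * n.

(* After [T] rounds player [p] knows a whole minimum spanning forest, and the
   edges reported by the other players belong to it. *)
Definition solves_msf (T : nat) (p : 'I_n) : Prop :=
  minimum_spanning_forest G (output (run T p)) /\
  forall v, output (run T v) \subset output (run T p).

End Execution.

(* [Q] executes [T] rounds of [P], spending [D] rounds on each of them: the
   state of each player of [P] can be read off from the state of the same
   player of [Q], and the final outputs agree. *)
Definition implements n (Q P : protocol n) (dec : state Q -> state P)
    (D T : nat) (G : wgraph n) : Prop :=
  (forall t v, t <= T -> dec (run Q G (D * t) v) = run P G t v) /\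
  (forall v, output (run Q G (D * T) v) = output (run P G T v)).

(* Main.v *)
(** Order the edges by weight, ties broken by endpoints, and let
    the rank of an edge be the smaller of its ranks among the edges at its two
    ends. For level [i >= 1] fix a set [S] of about [n / 2 ^ i] vertices meeting
    the [256 ^ i] lightest neighbours of all but [n / 2 ^ i] of the vertices that
    have more neighbours than that, and let every vertex join such a neighbour in
    [S]. An edge of rank in [[256 ^ i, 256 ^ i.+1[] is heavier than the joining
    edges at its ends, so contracting the resulting stars is harmless for it: if,
    among edges of this level, it closes a cycle of lighter edges in the
    contracted graph, then it is not in the minimum spanning forest. Hence any
    batch of level [i] can be cut down to [O(n / 2 ^ i)] edges. Player [r] starts
    with the edges of rank [r]; eight merges of [2 ^ i] batches at a time, as
    [256 ^ i = (2 ^ i) ^ 8], leave [O(1)] batches per level and [O(n)] edges in total, which go to one player.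

    The sets [S] come from [n] seeds of a pairwise independent family; a good
    seed for all levels is found by averaging, each vertex's contribution being
    evaluated by one of [O(m / n)] players that know all its edges. If there are
    fewer than [n] half-edges, a single such player knows the whole graph. *)

From mathcomp Require Import all_boot all_order all_algebra finfield.
From mathcomp Require Import boolp zify ring.
Require Import Defs.

Set Implicit Arguments.
Unset Strict Implicit.
Unset Printing Implicit Defensive.

Import Order.TTheory GRing.Theory Num.Theory.

(** * Forests and the minimum spanning forest *)

(** The protocol is not written as a state machine: each round only shows that inputs which a player
    cannot tell apart agree on what it has to send, and unrestricted local computation does the
    rest. The [O(m)] bound forces the case split on the number of half-edges: collecting one sum per
    seed or announcing the seed costs about [n] messages, affordable only with at least [n]
    half-edges. There are [n] seeds because player [s] adds up the terms of seed [s]. The sets [S]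
    are drawn with density [4 ^ -i], sparser than the target [2 ^ -i]: after weighting level [i] by
    [2 ^ i] the expected total is still a convergent series, so one seed serves all levels. Ranks
    spread the edges in one round, since a vertex has at most one edge of each rank at its own end.
    The size [n / 2 ^ i] fits the merges: [2 ^ i] batches of this size are what one player can
    receive, and each sender can own a block of [n / 2 ^ i] intermediate players. *)

Section Connect.

Variable n : nat.
Implicit Types (A B F : edge_set n) (e f : 'I_n * 'I_n) (x y : 'I_n).

Lemma adjE A x y : adj A x y = ((x, y) \in A) || ((y, x) \in A).
Proof. by []. Qed.

Definition conn A x y := connect (adj A) x y.

Lemma adj_sym A : symmetric (adj A).
Proof. by move=> x y; rewrite /adj /= orbC. Qed.

Lemma conn_sym A x y : conn A x y = conn A y x.
Proof. exact: (sym_connect_sym (@adj_sym A)). Qed.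

Lemma conn_refl A x : conn A x x.
Proof. exact: connect0. Qed.

Lemma conn_trans A y x z : conn A x y -> conn A y z -> conn A x z.
Proof. exact: connect_trans. Qed.

Lemma conn_square A x y a b : conn A x a -> conn A y b -> conn A x y -> conn A a b.
Proof. by rewrite conn_sym => ax yb xy; apply: conn_trans ax (conn_trans xy yb). Qed.

Lemma conn_edge A e : e \in A -> conn A e.1 e.2.
Proof. by case: e => u v uv; apply: connect1; apply/orP; left. Qed.

Lemma conn_min A (r : rel 'I_n) :
    (forall x, r x x) -> (forall y x z, r x y -> r y z -> r x z) ->
    (forall x y, r x y -> r y x) -> (forall e, e \in A -> r e.1 e.2) ->
  forall x y, conn A x y -> r x y.
Proof.
move=> r0 rT rS rA x y /connectP[p pP ->] {y}.
elim: p x pP => [|z p IHp] x //= /andP[xz /IHp]; apply: rT.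
by case/orP: xz => [/rA//|/rA/rS].
Qed.

Lemma conn_trans_sub A B : (forall e, e \in A -> conn B e.1 e.2) ->
  forall x y, conn A x y -> conn B x y.
Proof.
move=> AB; apply: conn_min => //; first exact: conn_refl.
- by move=> y x z; apply: conn_trans.
- by move=> x y; rewrite conn_sym.
Qed.

Lemma conn_sub A B x y : A \subset B -> conn A x y -> conn B x y.
Proof. by move=> /subsetP AB; apply: conn_trans_sub => e /AB; apply: conn_edge. Qed.

(** A path can be shortened until it uses [e] at most once; the last two cases are the two
    directions of crossing it. *)
Lemma conn_add A e x y : conn (e |: A) x y ->
  [\/ conn A x y, conn A x e.1 /\ conn A e.2 y | conn A x e.2 /\ conn A e.1 y].
Proof.
case/connectP=> p pP ->; elim: p x pP => [|z p IHp] x /=; first by constructor 1; apply: conn_refl.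
case/andP=> xz /IHp.
have [xzA|] := boolP (adj A x z).
  have xz' : conn A x z by apply: connect1.
  by case=> [?|[? ?]|[? ?]]; [constructor 1|constructor 2; split=> //|constructor 3; split=> //];
    apply: conn_trans xz' _.
rewrite /adj /= negb_or => /andP[/negPf n1 /negPf n2].
move: xz; rewrite /adj /= !in_setU1 n1 n2 !orbF => /orP[]/eqP <- /=.
  case=> [zy|[_ zy]|[_ xy]]; [constructor 2|constructor 2|constructor 1] => //; split=> //; exact: conn_refl.
case=> [zy|[_ xy]|[_ zy]]; [constructor 3|constructor 1|constructor 3] => //; split=> //; exact: conn_refl.
Qed.

(** Every edge is a bridge: acyclicity without closed walks, the form that exchange arguments
    use. *)
Definition forest F := forall e, e \in F -> ~~ conn (F :\ e) e.1 e.2.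

(** An inclusion-minimal connecting set stands in for the edge set of a simple path. *)
Lemma conn_minimal A x y : conn A x y ->
  exists D : edge_set n, [/\ D \subset A, conn D x y & forall e, e \in D -> ~~ conn (D :\ e) x y].
Proof.
move=> cA; have [D /minsetP[cD minD] DA] := @minset_exists _ (fun D => conn D x y) A cA.
exists D; split=> // e eD; apply/negP=> /minD/(_ (subD1set _ _)) De.
by have := setD11 e D; rewrite De eD.
Qed.

Lemma conn_through A e x y : conn A x y -> ~~ conn (A :\ e) x y -> 
  [\/ conn (A :\ e) x e.1 /\ conn (A :\ e) e.2 y | conn (A :\ e) x e.2 /\ conn (A :\ e) e.1 y].
Proof.
move=> cA ncA; have : conn (e |: (A :\ e)) x y.
  apply: conn_sub cA; apply/subsetP=> f fA; rewrite !inE fA andbT.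
  by case: eqP.
by case/conn_add => [c|c|c]; [rewrite c in ncA|left|right].
Qed.

Lemma adj_path_sub A B x p : {in x :: p &, subrel (adj A) (adj B)} ->
  path (adj A) x p -> path (adj B) x p.
Proof.
elim: p x => //= y p IHp x sub /andP[xy yp]; apply/andP; split.
  by apply: sub => //; rewrite !inE ?eqxx ?orbT.
by apply: IHp => // u v up vp; apply: sub; rewrite inE ?up ?vp orbT.
Qed.

(** An edge and a detour around it form a cycle, and conversely. Orienting all edges upwards
    excludes loops and reversed duplicates, so the detour has an inner vertex and the cycle at least
    three vertices. *)
Lemma acyclic_forest F : (forall e, e \in F -> e.1 < e.2) -> acyclic F <-> forest F.
Proof.
move=> Flt; split=> [acF [a b] eF|foF s s3 /andP[cs us]].
  have ab : a < b := Flt _ eF.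
  apply/negP=> /connectP[p0 p0P /= ep0]; move: ep0.
  case: (shortenP p0P) => {p0P p0} p pP up _ ep.
  have sub : subrel (adj (F :\ (a, b))) (adj F).
    by move=> u v; rewrite !adjE !inE => /orP[]/andP[_ ->]; rewrite ?orbT.
  apply: (acF (a :: p)).
    case: p pP up ep => [|d [|d' p]] //= pP up ep; first by rewrite ep ltnn in ab.
    move: pP; rewrite andbT -ep adjE !inE => /orP[/andP[]|/andP[_ /Flt/=]].
      by rewrite eqxx.
    by rewrite ltnNge ltnW.
  by rewrite /ucycle up andbT /= rcons_path (sub_path sub pP) /= -ep adjE eF orbT.
case: s s3 cs us => [|x [|y s]] //= s3 /andP[xy pys] /and3P[].
rewrite inE negb_or => /andP[xy' xs] ys us.
have [e eF exy] : exists2 e, e \in F & (e = (x, y)) \/ (e = (y, x)).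
  by case/orP: xy => h; [exists (x, y)|exists (y, x)]; auto.
have xyF u v : (u, v) != (x, y) -> (u, v) != (y, x) -> adj F u v -> adj (F :\ e) u v.
  rewrite !adjE !inE => h1 h2 /orP[]->; rewrite andbT; apply/orP; [left|right];
    by apply: contraNneq h1 => uve; case: exy uve h2 => -> [-> ->]; rewrite ?eqxx.
have c2 : conn (F :\ e) y x.
  apply/connectP; exists (rcons s x); last by rewrite last_rcons.
  move: pys; rewrite !rcons_path => /andP[pys lx]; apply/andP; split.
    apply: adj_path_sub pys => u v up vp.
    have [ux vx] : u != x /\ v != x.
      have xys : x \notin y :: s by rewrite inE negb_or xy'.
      by split; [apply: contraNneq xys => <-|apply: contraNneq xys => <-].
    by apply: xyF; rewrite xpair_eqE negb_and ?ux ?vx ?orbT.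
  (* Here the cycle needs a third vertex: otherwise its closing edge would be [e] again. *)
  have ly : last y s != y.
    case: s s3 ys {xs us pys lx} => //= a s _; apply: contraNneq => <-; exact: mem_last.
  have lx' : last y s != x.
    by apply: contraTneq (mem_last y s) => ->; rewrite inE negb_or xy'.
  by apply: xyF lx; rewrite xpair_eqE negb_and ?ly ?lx'.
by move: c2 (foF e eF); case: exy => -> c2 /=; rewrite ?c2 // conn_sym c2.
Qed.

End Connect.

(** * The cycle rule for distinct keys, exchange of edges, and contraction *)

Section Msf.

Variables (n : nat) (key : 'I_n * 'I_n -> int).
Hypothesis key_inj : injective key.
Implicit Types (A F R : edge_set n) (e f : 'I_n * 'I_n).

Definition lighter F e := [set f in F | (key f < key e)%R].

(** Kruskal's forest without the algorithm: an edge is rejected exactly when lighter edges already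
    join its ends. *)
Definition msf F := [set e in F | ~~ conn (lighter F e) e.1 e.2].

Lemma msf_sub F : msf F \subset F.
Proof. by apply/subsetP=> e; rewrite inE => /andP[]. Qed.

Lemma lighterS F R e : F \subset R -> lighter F e \subset lighter R e.
Proof. by move=> /subsetP FR; apply/subsetP=> f; rewrite !inE => /andP[/FR->]. Qed.

(** Induction on the number of lighter edges: the ends of a rejected edge are joined by lighter
    edges, each of which can be replaced by forest edges no heavier than itself. *)
Lemma msf_conn_le F e : e \in F -> conn [set f in msf F | (key f <= key e)%R] e.1 e.2.
Proof.
move: {2}#|_|.+1 (ltnSn #|lighter F e|) => k; elim: k e => // k IHk e kF eF.
have [emsf|] := boolP (e \in msf F).
  by apply: conn_edge; rewrite inE emsf lexx.
rewrite inE eF /= negbK; apply: conn_trans_sub => f; rewrite inE => /andP[fF fe].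
apply: conn_sub (IHk f _ fF).
  by apply/subsetP=> g; rewrite !inE => /andP[-> /le_trans->] //; apply: ltW.
rewrite ltnS in kF; apply: leq_trans kF; apply: proper_card; apply/properP; split.
  by apply/subsetP=> g; rewrite !inE => /andP[-> /lt_trans->].
by exists f; rewrite !inE fF ?fe ?ltxx.
Qed.

Lemma msf_conn_lighter F e x y :
  conn (lighter F e) x y -> conn (lighter (msf F) e) x y.
Proof.
apply: conn_trans_sub => f; rewrite inE => /andP[fF fe].
apply: conn_sub (msf_conn_le fF); apply/subsetP=> g; rewrite !inE => /andP[-> gf].
exact: le_lt_trans gf fe.
Qed.

Lemma msf_conn F x y : conn F x y = conn (msf F) x y.
Proof.
apply/idP/idP; last exact: conn_sub (msf_sub F).
apply: conn_trans_sub => e eF; apply: conn_sub (msf_conn_le eF).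
by apply/subsetP=> f; rewrite !inE => /andP[].
Qed.

(** The edges of [F] below a key and those of [msf F] below it connect the same vertices, and [R]
    lies in between. This justifies discarding edges, as long as the forest is kept. *)
Lemma msf_restrict F R : msf F \subset R -> R \subset F -> msf R = msf F.
Proof.
move=> FR RF; apply/setP=> e; rewrite [in LHS]inE [in RHS]inE.
apply/andP/andP=> -[eR ne]; split.
- exact: (subsetP RF).
- apply: contraNN ne => /msf_conn_lighter; apply: conn_sub; exact: lighterS.
- by apply: (subsetP FR); rewrite inE eR.
- by apply: contraNN ne; apply: conn_sub; apply: lighterS.
Qed.

Lemma exists_max F e : e \in F -> exists2 g, g \in F & forall f, f \in F -> (key f <= key g)%R.
Proof.
by move=> eF; case: (Order.TotalTheory.arg_maxP key eF) => g gF gmax; exists g.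
Qed.

(* The heaviest edge on the cycle closed by [e] would not survive in [msf F]. *)
Lemma heavier_bridge F A e : e \in msf F -> A \subset F -> conn A e.1 e.2 ->
  exists (g : 'I_n * 'I_n) (D : edge_set n),
    [/\ g \in D, D \subset A, (key e <= key g)%R,
      forall f, f \in D -> (key f <= key g)%R & conn (e |: (D :\ g)) g.1 g.2].
Proof.
rewrite inE => /andP[eF ne] AF /conn_minimal[D [DA cD minD]].
have [h hD he] : exists2 h, h \in D & (key e <= key h)%R.
  have [/exists_inP[h]|/exists_inPn nh] := boolP [exists h in D, (key e <= key h)%R].
    by exists h.
  case/negP: ne; apply: conn_sub cD; apply/subsetP=> f fD; rewrite inE.
  by rewrite (subsetP AF) ?(subsetP DA) //= ltNge nh.
have [g gD gmax] := exists_max hD.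
have cg : conn (e |: (D :\ g)) g.1 g.2.
  have ce : conn (e |: (D :\ g)) e.1 e.2 by apply: conn_edge; rewrite setU11.
  have up x y : conn (D :\ g) x y -> conn (e |: (D :\ g)) x y.
    exact/conn_sub/subsetUr.
  case: (conn_through cD (minD g gD)) => -[/up c1 /up c2].
    by apply: conn_square ce => //; rewrite conn_sym.
  by rewrite conn_sym; apply: conn_square ce => //; rewrite conn_sym.
by exists g, D; split=> //; apply: le_trans (gmax h hD).
Qed.

(** The heaviest edge of a cycle has its ends joined by the lighter rest of the cycle, so it would
    have been rejected. *)
Lemma msf_forest F : forest (msf F).
Proof.
move=> e eM; apply/negP=> ce.
have eF := subsetP (msf_sub F) e eM.
have AF : msf F :\ e \subset F := subset_trans (subsetDl _ _) (msf_sub F).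
have [g [D [gD DA eg Dg cg]]] := heavier_bridge eM AF ce.
have /setD1P[ge gM] := subsetP DA g gD; move: gM; rewrite inE => /andP[gF /negP[]].
apply: conn_sub cg; apply/subsetP=> f; rewrite !inE => /orP[/eqP->|/andP[fg fD]].
  rewrite eF lt_neqAle eg andbT; apply: contraNneq ge => /key_inj->; exact: eqxx.
rewrite (subsetP AF) ?(subsetP DA) //= lt_neqAle Dg // andbT.
by apply: contraNneq fg => /key_inj->.
Qed.

(** The last hypothesis puts [g] on the cycle closed by [e], so the swap keeps the components. A new
    cycle through some [f] would have to use [e]; then [F :\ g] would join the ends of [e], hence
    those of [g]. *)
Lemma forest_exchange F e g : forest F -> e \notin F -> g \in F ->
    conn F e.1 e.2 -> conn (e |: (F :\ g)) g.1 g.2 ->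
  forest (e |: (F :\ g)) /\ forall x y, conn (e |: (F :\ g)) x y = conn F x y.
Proof.
move=> foF eF gF ce cg; have ng := foF g gF.
have same x y : conn (e |: (F :\ g)) x y = conn F x y.
  apply/idP/idP; apply: conn_trans_sub => f.
    by rewrite !inE => /orP[/eqP->//|/andP[_ /conn_edge]].
  move=> fF; have [->//|fg] := eqVneq f g; apply: conn_edge.
  by rewrite !inE fg fF orbT.
have ne : ~~ conn (F :\ g) e.1 e.2.
  apply: contraNN ng => ne; apply: conn_trans_sub cg => f.
  by rewrite in_setU1 => /orP[/eqP->//|/conn_edge].
split=> // f; rewrite in_setU1 => /orP[/eqP->|fFg].
  by rewrite setU1K // !inE negb_and eF orbT.
have /setD1P[fg fF] := fFg.
have fe : f != e by apply: contraNneq eF => <-.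
have -> : (e |: (F :\ g)) :\ f = e |: (F :\ g :\ f).
  by apply/setP=> h; rewrite !inE; case: (h =P e) => [->|] //=; rewrite eq_sym fe.
have sub : F :\ g :\ f \subset F :\ f by apply: setSD; apply: subsetDl.
have up x y : conn (F :\ g :\ f) x y -> conn (F :\ g) x y by apply/conn_sub/subsetDl.
have cf : conn (F :\ g) f.1 f.2 by apply: conn_edge.
apply/negP=> /conn_add[c|[/up c1 /up c2]|[/up c1 /up c2]].
- by have /negP[] := foF f fF; apply: conn_sub c.
- by case/negP: ne; apply: conn_square cf => //; rewrite conn_sym.
- by case/negP: ne; rewrite conn_sym; apply: conn_square cf => //; rewrite conn_sym.
Qed.

Definition contract (cl : 'I_n -> 'I_n) A : edge_set n := [set (cl f.1, cl f.2) | f in A].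

(** The cycle rule for the batch [A] in the contracted graph. Keys are compared before contracting,
    since several edges of [A] may have the same image. *)
Definition survivors (cl : 'I_n -> 'I_n) A :=
  [set e in A | ~~ conn (contract cl (lighter A e)) (cl e.1) (cl e.2)].

(** A contracted connection by lighter edges lifts to [F]: each edge [f] on it is linked to the
    clusters of its ends by edges lighter than [f], hence lighter than [e]. *)
Lemma msf_survivors cl F A : A \subset F ->
    (forall e, e \in A -> conn (lighter F e) e.1 (cl e.1) /\ conn (lighter F e) e.2 (cl e.2)) ->
  forall e, e \in A -> e \in msf F -> e \in survivors cl A.
Proof.
move=> AF Acl e eA; rewrite !inE eA => /andP[_]; apply: contraNN => c.
have [c1 c2] := Acl e eA; apply: (@conn_square _ _ (cl e.1) (cl e.2)); [by rewrite conn_sym|by rewrite conn_sym|].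
apply: conn_trans_sub c => _ /imsetP[f fA ->] /=.
move: fA; rewrite inE => /andP[fA fe]; have [f1 f2] := Acl f fA.
have up x y : conn (lighter F f) x y -> conn (lighter F e) x y.
  by apply: conn_sub; apply/subsetP=> h; rewrite !inE => /andP[-> /lt_trans->].
apply: conn_square (up _ _ f1) (up _ _ f2) _; apply: conn_edge.
by rewrite inE fe andbT (subsetP AF).
Qed.

(** The survivors are a forest on [V] after contraction. The induction carries a set [R] of
    representatives that reaches all of [V]; every surviving edge joins two components and releases
    one representative. *)
Lemma card_survivors cl A (V : {set 'I_n}) :
  (forall e, e \in A -> cl e.1 \in V /\ cl e.2 \in V) -> #|survivors cl A| <= #|V|.
Proof.
move=> AV; set Y := survivors cl A.
have YV e : e \in Y -> cl e.1 \in V /\ cl e.2 \in V by rewrite inE => /andP[/AV].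
have Yn e : e \in Y -> ~~ conn (contract cl (lighter Y e)) (cl e.1) (cl e.2).
  rewrite inE => /andP[_]; apply: contraNN; apply: conn_sub; apply: imsetS; apply: lighterS.
  by apply/subsetP=> f; rewrite inE => /andP[].
suff [R RV _] : exists2 R : {set 'I_n}, #|R| + #|Y| = #|V| &
    forall x, x \in V -> exists2 r, r \in R & conn (contract cl Y) x r.
  by rewrite -RV leq_addl.
clearbody Y; clear AV; move: {2}#|Y| (erefl #|Y|) => k; elim: k Y YV Yn => [|k IHk] Y YV Yn kY.
  by exists V; [rewrite kY addn0|move=> x xV; exists x => //; apply: conn_refl].
have [e0 e0Y] : exists e, e \in Y by apply/set0Pn; rewrite -card_gt0 kY.
have [e eY emax] := exists_max e0Y.
(* Splitting off the heaviest edge makes its lighter edges all the remaining ones. *)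
have lY : lighter Y e = Y :\ e.
  apply/setP=> f; rewrite !inE; case fY: (f \in Y); rewrite ?andbF //= andbT.
  by rewrite lt_neqAle emax // andbT (inj_eq key_inj).
have kY' : #|Y :\ e| = k by apply/eqP; rewrite -eqSS -kY [in X in _ == X](cardsD1 e) eY.
have [f|f|//|R RV Rc] := IHk (Y :\ e).
- by rewrite inE => /andP[_ /YV].
- rewrite inE => /andP[_ /Yn]; apply: contraNN; apply: conn_sub; apply: imsetS.
  by apply: lighterS; apply: subsetDl.
have [[ra raR ca] [rb rbR cb]] := (Rc _ (YV e eY).1, Rc _ (YV e eY).2).
have nab := Yn e eY; rewrite lY in nab.
have rab : rb != ra.
  apply: contraNneq nab => rba; rewrite rba conn_sym in cb; apply: conn_trans ca cb.
have up x y : conn (contract cl (Y :\ e)) x y -> conn (contract cl Y) x y.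
  by apply: conn_sub; apply: imsetS; apply: subsetDl.
exists (R :\ rb).
  by rewrite -RV kY kY' (cardsD1 rb R) rbR add1n addSnnS.
move=> x /Rc[r rR /up cr]; have [rrb|rrb] := eqVneq r rb; last first.
  by exists r; rewrite // !inE rrb.
exists ra; first by rewrite !inE eq_sym rab.
rewrite rrb in cr; apply: conn_trans cr _; rewrite conn_sym.
apply: conn_square (up _ _ ca) (up _ _ cb) _.
by apply: (@conn_edge _ _ (cl e.1, cl e.2)); apply/imsetP; exists e.
Qed.

End Msf.

(** * Tie-breaking, and optimality among all spanning forests *)

Section Optimal.

Variable n : nat.
Implicit Types (G : wgraph n) (F : edge_set n) (e : 'I_n * 'I_n).

Definition idx e : nat := e.1 * n + e.2.

Lemma idx_inj : injective idx.
Proof.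
move=> [a b] [a' b']; rewrite /idx /= => eqi.
have n0 : 0 < n := leq_ltn_trans (leq0n a) (ltn_ord a).
have := congr1 (divn^~ n) eqi; rewrite !divnMDl // !divn_small ?ltn_ord // !addn0 => aa.
by have := congr1 (modn^~ n) eqi; rewrite !modnMDl !modn_small // => bb; congr pair; apply/val_inj.
Qed.

Lemma idx_lt e : idx e < n ^ 2.
Proof.
rewrite /idx -mulnn; have := ltn_ord e.1; have := ltn_ord e.2.
by move=> h2 h1; apply: leq_trans (leq_mul h1 (leqnn n)); rewrite mulSn addnC ltn_add2r.
Qed.

(* The weight dominates and [idx] breaks ties, even after summing over all edges. *)
Definition key G e : int := (odflt 0 (G e.1 e.2) * (n ^ 4).+1%:Z + (idx e)%:Z)%R.

Lemma key_inj G : injective (key G).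
Proof.
move=> e f; rewrite /key => eqk; apply: idx_inj.
have := idx_lt e; have := idx_lt f; have : n ^ 2 <= n ^ 4.
  by case: (n) => // m; rewrite leq_pexp2l.
move: eqk; move: (odflt _ _) (odflt _ _) (n ^ 4) (n ^ 2) (idx e) (idx f) => a b N M i j.
by case: (ltgtP a b) => ab; nia.
Qed.

Lemma edges_lt G e : e \in edges G -> e.1 < e.2.
Proof. by rewrite inE => /andP[]. Qed.

Lemma sum_key G F : (\sum_(e in F) key G e = weight G F * (n ^ 4).+1%:Z + (\sum_(e in F) idx e)%:Z)%R.
Proof.
rewrite big_split /= -mulr_suml -/(weight G F); congr (_ + _)%R.
by rewrite (big_morph Posz PoszD (erefl _)).
Qed.

(** The origin of the factor [(n ^ 4).+1] in [key]: the tie-breaking terms of a whole edge set stay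
    below one unit of weight. *)
Lemma sum_idx F : \sum_(e in F) idx e <= n ^ 4.
Proof.
apply: leq_trans (leq_sum _ (fun e _ => ltnW (idx_lt e))) _.
rewrite sum_nat_const -[4]/(2 + 2) expnD leq_mul2r; apply/orP; right.
by apply: leq_trans (max_card _) _; rewrite card_prod card_ord mulnn.
Qed.

Lemma msf_spanning G : spanning_forest G (msf (key G) (edges G)).
Proof.
split; first exact: msf_sub.
- apply/acyclic_forest; last exact/msf_forest/key_inj.
  by move=> e /(subsetP (msf_sub _ _))/edges_lt.
- by move=> u v; apply/esym/msf_conn.
Qed.

(** A spanning forest of least total key contains every edge of [msf], as a missing one could be
    exchanged for a heavier edge; since [msf] already spans, the two are equal. *)
Lemma msf_minimum G : minimum_spanning_forest G (msf (key G) (edges G)).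
Proof.
split=> [|F' spF']; first exact: msf_spanning.
pose sp F := [&& F \subset edges G, [forall e in F, ~~ conn (F :\ e) e.1 e.2] &
  [forall x, forall y, conn F x y == conn (edges G) x y]].
have spP F : spanning_forest G F -> sp F.
  case=> FE /acyclic_forest Fo Fc; apply/and3P; split=> //.
    by apply/forall_inP/Fo => e /(subsetP FE)/edges_lt.
  by apply/forallP=> x; apply/forallP=> y; apply/eqP/Fc.
case: (Order.TotalTheory.arg_minP (fun F => \sum_(e in F) key G e)%R (spP _ spF')).
move=> F /and3P[FE /forall_inP Fo /forallP Fc] Fmin.
have Fconn x y : conn F x y = conn (edges G) x y.
  by have /forallP/(_ y)/eqP := Fc x.
have MF : msf (key G) (edges G) \subset F.
  apply/subsetP=> e eM; apply/negPn/negP=> eF.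
  have eE := subsetP (msf_sub _ _) e eM.
  have ce : conn F e.1 e.2 by rewrite Fconn; apply: conn_edge.
  have [g [D [gD DF eg _ cg]]] := heavier_bridge eM FE ce.
  have gF := subsetP DF g gD.
  have cg' : conn (e |: (F :\ g)) g.1 g.2 by apply: conn_sub cg; apply/setUS/setSD.
  have [Fo' Fc'] := forest_exchange Fo eF gF ce cg'.
  have : sp (e |: (F :\ g)).
    apply/and3P; split; last by apply/forallP=> x; apply/forallP=> y; rewrite Fc' Fconn.
      by rewrite subUset sub1set eE (subset_trans (subsetDl _ _)).
    exact/forall_inP.
  move=> /Fmin; rewrite big_setU1 /=; last by rewrite !inE (negPf eF) andbF.
  rewrite (big_setD1 g gF) /= lerD2r => ge.
  have /key_inj ege : key G e = key G g by apply/eqP; rewrite eq_le eg ge.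
  by rewrite ege gF in eF.
have FM : F = msf (key G) (edges G).
  apply/eqP; rewrite eqEsubset MF andbT; apply/subsetP=> f fF; apply/negPn/negP=> fM.
  case/negP: (Fo f fF); have : conn (msf (key G) (edges G)) f.1 f.2.
    by rewrite -msf_conn; apply/conn_edge/(subsetP FE).
  apply: conn_sub; apply/subsetP=> h hM; rewrite !inE (subsetP MF h hM) andbT.
  by apply: contraNneq fM => <-.
(* Least total key implies least weight: a weight difference of one outweighs all the [idx]
   terms. *)
have := Fmin _ (spP _ spF'); rewrite !sum_key -FM.
have := sum_idx F; have := sum_idx F'.
move: (\sum_(e in F) _)%N (\sum_(e in F') _)%N (weight G F) (weight G F') (n ^ 4) => a b x y N.
move=> h1 h2 h3; rewrite leNgt; apply/negP=> h4; nia.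
Qed.

End Optimal.

(** * What players can learn *)

Lemma finType_code (I : finType) (b : nat) : #|I| <= 2 ^ b ->
  exists f : I -> seq bool, (forall x, size (f x) = b) /\ injective f.
Proof.
move=> Ib; have Eb : 2 ^ b = #|{: b.-tuple bool}| by rewrite card_tuple card_bool.
pose g (x : I) : b.-tuple bool := enum_val (cast_ord Eb (widen_ord Ib (enum_rank x))).
exists (fun x => tval (g x)); split=> [x|x y /val_inj]; first exact: size_tuple.
by move=> /enum_val_inj/cast_ord_inj/(congr1 val) /= /val_inj/enum_rank_inj.
Qed.

Lemma flatten_map_inj (I : Type) (f : I -> seq bool) (b : nat) :
    (forall x, size (f x) = b.+1) -> injective f ->
  injective (fun s : seq I => flatten (map f s)).
Proof.
move=> fb f_inj; elim=> [|x s IHs] [|y t] //= /eqP.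
- by rewrite eq_sym -size_eq0 size_cat fb.
- by rewrite -size_eq0 size_cat fb.
- by rewrite eqseq_cat ?fb // => /andP[/eqP/f_inj-> /eqP/IHs->].
Qed.

Lemma set_code (I : finType) (b : nat) : #|I| <= 2 ^ b ->
  exists f : {set I} -> seq bool,
    (forall A, size (f A) = #|A| * b.+1) /\ injective f.
Proof.
(* The leading [true] keeps the words nonempty when [b = 0], so that their concatenation can still
   be split. *)
case/finType_code=> f [fb f_inj]; pose g x := true :: f x.
have gb x : size (g x) = b.+1 by rewrite /= fb.
have g_inj : injective g by move=> x y [/f_inj].
exists (fun A : {set I} => flatten (map g (enum A))); split=> [A|A B].
  rewrite size_flatten /shape -map_comp cardE.
  by elim: (enum A) => //= x s ->; rewrite fb mulSn.
by move/(flatten_map_inj gb g_inj)=> eqAB; apply/setP=> x; rewrite -mem_enum eqAB mem_enum.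
Qed.

(** * Protocols described by indistinguishability of inputs *)

Section Knowledge.

Variables c n : nat.
Implicit Types G : wgraph n.

Notation poly G := (poly_weights c G).

(* A protocol is described from outside: [M t G u v] is what [u] sends to [v]
   in round [t] on input [G].  It is executable as soon as it is local, i.e.
   inputs that [u] cannot tell apart yield the same messages from [u]. *)
Definition same_view (M : nat -> wgraph n -> 'I_n -> 'I_n -> seq message) t u G G' :=
  wt G u = wt G' u /\ forall s, s < t -> forall w, M s G w u = M s G' w u.

(* [E u G G'] bounds the ignorance of [u] after [T] rounds: two inputs that
   [u] cannot distinguish are related by [E u]. *)
Definition computable (K T : nat) (E : 'I_n -> wgraph n -> wgraph n -> Prop) :=
  exists M : nat -> wgraph n -> 'I_n -> 'I_n -> seq message,
  [/\ forall t u G G', t < T -> poly G -> poly G' -> same_view M t u G G' ->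
        M t G u = M t G' u,
      forall t u v G, t < T -> poly G -> size (M t G u v) <= 1,
      forall t u v G msg, t < T -> poly G -> msg \in M t G u v ->
        size msg <= K * up_log 2 n,
      forall t G, t < T -> poly G ->
        \sum_u \sum_v size (M t G u v) <= K * #|edges G|
    & forall u G G', poly G -> poly G' -> same_view M T u G G' -> E u G G'].

Lemma computable_weaken K T (E E' : 'I_n -> wgraph n -> wgraph n -> Prop) :
    (forall u G G', poly G -> poly G' -> E u G G' -> E' u G G') ->
  computable K T E -> computable K T E'.
Proof.
move=> EE' [M [M1 M2 M3 M4 M5]]; exists M; split=> // u G G' pG pG' /M5 E1.
by apply: EE' => //; apply: E1.
Qed.

Lemma computable_row K : computable K 0 (fun u G G' => wt G u = wt G' u).
Proof. by exists (fun _ _ _ _ => [::]); split=> // u G G' _ _ []. Qed.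

Lemma edges_small G : n <= 1 -> edges G = set0.
Proof.
move=> n1; apply/setP=> -[u v]; rewrite !inE /=; case: ltnP => //= uv.
by have := leq_trans (leq_ltn_trans uv (ltn_ord v)) n1.
Qed.

(** One round in which up to [Cap] items are packed into a single message. The empty set is encoded
    by silence, so the number of messages is bounded by the number of items. *)
Lemma computable_step K T E (I : finType) (Cap k : nat)
    (M : wgraph n -> 'I_n -> 'I_n -> {set I}) :
    Cap * k.+1 <= K -> (2 <= n -> #|I| <= n ^ k) ->
    (forall u G G', poly G -> poly G' -> E u G G' -> M G u = M G' u) ->
    (forall u v G, poly G -> #|M G u v| <= Cap) ->
    (forall G, poly G -> \sum_u \sum_v #|M G u v| <= K * #|edges G|) ->
  computable K T E ->
  computable K T.+1 (fun u G G' => E u G G' /\ forall w, M G w u = M G' w u).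
Proof.
move=> CapK In Mloc Mcap Mcost [M0 [loc one len cost know]].
pose b := k * up_log 2 n.
have [f [flen f_inj]] : exists f : {set I} -> seq bool,
    (forall A, 2 <= n -> size (f A) = #|A| * b.+1) /\ (2 <= n -> injective f).
  have [n2|_] := leqP 2 n; last by exists (fun _ => [::]).
  have /set_code[f [f1 f2]] : #|I| <= 2 ^ b.
    apply: leq_trans (In n2) _; rewrite /b mulnC expnM.
    by case: (k) => // k'; rewrite leq_exp2r // up_logP.
  by exists f; split.
(* For [n = 1] a message has [up_log 2 1 = 0] bits; there are no edges then, and the cost bound
   rules out any message. *)
have M0E G u v : poly G -> n < 2 -> M G u v = set0.
  move=> pG n2; have := Mcost G pG; rewrite edges_small // cards0 muln0 leqn0.
  rewrite sum_nat_eq0 => /forallP/(_ u)/= ; rewrite sum_nat_eq0.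
  by move=> /forallP/(_ v)/=; rewrite cards_eq0 => /eqP.
pose code A := if A == set0 then [::] else [:: f A].
have code_inj G G' u v u' v' : poly G -> poly G' ->
    code (M G u v) = code (M G' u' v') -> M G u v = M G' u' v'.
  move=> pG pG'; have [n2|n2] := leqP 2 n; last by rewrite !M0E.
  by rewrite /code; case: eqP => [->|_]; case: eqP => [->|_] // -[/(f_inj n2)].
exists (fun t G u v => if t == T then code (M G u v) else M0 t G u v).
set M' := fun t => _.
have view t u G G' : t <= T -> same_view M' t u G G' -> same_view M0 t u G G'.
  move=> tT [r m]; split=> // s st w; have := m s st w.
  by rewrite /M' ltn_eqF // (leq_trans st).
have cases t : t < T.+1 -> t = T \/ (t < T /\ (t == T) = false).
  by rewrite ltnS leq_eqVlt => /orP[/eqP|tT]; [left|right; rewrite ltn_eqF].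
split.
- move=> t u G G' /cases[->|[tT tTF]] pG pG' sv; last first.
    by rewrite /M' tTF; apply: loc => //; apply: view sv => //; apply: ltnW.
  rewrite /M' eqxx (Mloc u G G') //; apply: know => //; exact: view sv.
- move=> t u v G /cases[->|[tT tTF]] pG; rewrite /M' ?eqxx ?tTF; last exact: one.
  by rewrite /code; case: ifP.
- move=> t u v G msg /cases[->|[tT tTF]] pG; rewrite /M' ?eqxx ?tTF; last exact: len.
  rewrite /code; case: eqP => // /eqP MN0; rewrite inE => /eqP->.
  have n2 : 2 <= n by rewrite ltnNge; apply: contraNN MN0 => n2; rewrite M0E // ltnS.
  rewrite flen //; apply: leq_trans (leq_mul CapK (leqnn _)); rewrite -mulnA.
  apply: leq_mul; first exact: Mcap.
  by rewrite /b mulSn -addn1 addnC leq_add2r up_log_gt0.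
- move=> t G /cases[->|[tT tTF]] pG; rewrite /M' ?eqxx ?tTF; last exact: cost.
  apply: leq_trans (Mcost G pG); apply: leq_sum => u _; apply: leq_sum => v _.
  by rewrite /code; case: eqP => // /eqP; rewrite -card_gt0.
move=> u G G' pG pG' sv; split.
  apply: know => //; case: sv => r m; apply: (view T) => //; split=> // s sT w.
  exact: m (ltnW sT) w.
move=> w; case: sv => _ /(_ T (ltnSn T) w); rewrite /M' eqxx; exact: code_inj.
Qed.

(* Every item travels from its source through an intermediate player to the
   player [dst] that can be read off from the item itself. *)
Lemma computable_route K T E (J I : finType) (Cap k : nat)
    (A : wgraph n -> 'I_n -> {set J}) (deco : wgraph n -> J -> I)
    (mid : wgraph n -> 'I_n -> J -> 'I_n) (dst : I -> 'I_n) :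
    Cap * k.+1 <= K -> (2 <= n -> #|I| <= n ^ k) ->
    (forall u G G', poly G -> poly G' -> E u G G' ->
       [/\ A G u = A G' u, {in A G u, deco G =1 deco G'}
         & {in A G u, mid G u =1 mid G' u}]) ->
    (forall u w G, poly G -> #|[set e in A G u | mid G u e == w]| <= Cap) ->
    (forall w v G, poly G ->
       #|\bigcup_u [set e in A G u | (mid G u e == w) && (dst (deco G e) == v)]| <= Cap) ->
    (forall G, poly G -> \sum_u #|A G u| <= K * #|edges G|) ->
  computable K T E ->
  computable K T.+2 (fun u G G' => E u G G' /\
    [set deco G e | e in \bigcup_v A G v & dst (deco G e) == u]
      = [set deco G' e | e in \bigcup_v A G' v & dst (deco G' e) == u]).
Proof.
move=> CapK In Aloc Acap1 Acap2 Acost cE.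
pose M1 G u w := [set deco G e | e in A G u & mid G u e == w].
pose M2 G w v := [set x in \bigcup_u M1 G u w | dst x == v].
have M2E G w v : M2 G w v =
    [set deco G e | e in \bigcup_u [set e in A G u | (mid G u e == w) && (dst (deco G e) == v)]].
  apply/setP=> x; rewrite inE; apply/andP/imsetP.
    case=> /bigcupP[u _ /imsetP[e]]; rewrite inE => /andP[eA me] -> de.
    by exists e => //; apply/bigcupP; exists u => //; rewrite inE eA me.
  case=> e /bigcupP[u _]; rewrite inE => /and3P[eA me de] ->; split=> //.
  by apply/bigcupP; exists u => //; apply/imsetP; exists e; rewrite // inE eA.
have c1 : computable K T.+1 (fun u G G' => E u G G' /\ forall w, M1 G w u = M1 G' w u).
  apply: (@computable_step K T E I Cap k) cE => //.
  - move=> u G G' pG pG' /(Aloc u G G' pG pG')[eA ed em]; apply/funext=> w.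
    apply/setP=> x; apply/imsetP/imsetP => -[e]; rewrite inE => /andP[eA' /eqP me] ->.
      by exists e; rewrite ?ed // inE -eA eA' -em // me eqxx.
    by rewrite -eA in eA'; exists e; rewrite ?ed // inE eA' em // me eqxx.
  - by move=> u w G pG; apply: leq_trans (leq_imset_card _ _) (Acap1 u w G pG).
  - move=> G pG; apply: leq_trans (Acost G pG); apply: leq_sum => u _.
    apply: leq_trans (leq_sum _ (fun w _ => leq_imset_card _ _)) _.
    rewrite -[#|A G u|]sum1_card (partition_big (mid G u) predT) //=.
    by apply: leq_sum => w _; rewrite sum1dep_card.
have c2 : computable K T.+2 (fun u G G' =>
    (E u G G' /\ forall w, M1 G w u = M1 G' w u) /\ forall w, M2 G w u = M2 G' w u).
  apply: (@computable_step K T.+1 _ I Cap k) c1 => //.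
  - move=> u G G' pG pG' [_ eM]; apply/funext=> v; rewrite /M2.
    by rewrite (eq_bigr (fun w => M1 G' w u)) // => w _; rewrite eM.
  - by move=> w v G pG; rewrite M2E; apply: leq_trans (leq_imset_card _ _) (Acap2 w v G pG).
  - move=> G pG; apply: leq_trans (Acost G pG).
    have le1 w : \sum_v #|M2 G w v| <= \sum_u #|M1 G u w|.
      have ->: \sum_v #|M2 G w v| = #|\bigcup_u M1 G u w|.
        rewrite -[RHS]sum1_card (partition_big dst predT) //=.
        by apply: eq_bigr => v _; rewrite sum1dep_card.
      elim/big_rec2: _ => [|i x X _ h]; first by rewrite cards0.
      by apply: leq_trans (leq_card_setU _ _) _; rewrite leq_add2l.
    apply: leq_trans (leq_sum _ (fun w _ => le1 w)) _; rewrite exchange_big /=.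
    apply: leq_sum => u _.
    apply: leq_trans (leq_sum _ (fun w _ => leq_imset_card _ _)) _.
    rewrite -[#|A G u|]sum1_card (partition_big (mid G u) predT) //=.
    by apply: leq_sum => w _; rewrite sum1dep_card.
apply: computable_weaken c2 => u G G' _ _ [[EG _] eM]; split=> //.
have setE G0 : [set deco G0 e | e in \bigcup_v A G0 v & dst (deco G0 e) == u]
    = \bigcup_w M2 G0 w u.
  apply/setP=> x; apply/imsetP/bigcupP.
    case=> e; rewrite inE => /andP[/bigcupP[v _ eA] de] ->.
    exists (mid G0 v e) => //; rewrite M2E; apply/imsetP; exists e => //.
    by apply/bigcupP; exists v; rewrite // inE eA eqxx.
  case=> w _; rewrite M2E => /imsetP[e /bigcupP[v _]]; rewrite inE => /and3P[eA _ de] ->.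
  by exists e; rewrite // inE de andbT; apply/bigcupP; exists v.
by rewrite !setE; apply: eq_bigr => w _.
Qed.

(** The state of a player stores its identifier, its row and all inboxes so far. To act, the player
    picks by choice any input consistent with its state and behaves as on that input; locality makes
    the result independent of the pick. *)
Lemma computable_protocol K T E (F : wgraph n -> edge_set n) (p : 'I_n) :
    computable K T E ->
    (forall G G', poly G -> poly G' -> E p G G' -> F G = F G') ->
  exists P : protocol n, forall G, poly G ->
    [/\ congested_clique P G K T,
        output (run P G T p) = F G,
        forall v, v != p -> output (run P G T v) = set0
      & communication P G T <= T * K * #|edges G|].
Proof.
move=> [M [loc one len cost know]] EF.
pose S : Type := ('I_n * ('I_n -> option int) * seq ('I_n -> seq message))%type.
pose hist G t u := [seq (fun w => M s G w u) | s <- iota 0 t].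
pose ok (s : S) G := poly G /\ s = (s.1.1, wt G s.1.1, hist G (size s.2) s.1.1).
have okE G t u : poly G -> ok (u, wt G u, hist G t u) G.
  by move=> pG; split=> //=; rewrite size_map size_iota.
have okV G G' t u : ok (u, wt G u, hist G t u) G' -> same_view M t u G' G.
  rewrite /ok /= size_map size_iota => -[_ [r h]]; split=> // s st w.
  have := congr1 (fun l => nth (fun=> [::]) l s w) h.
  by rewrite !(nth_map 0) ?size_iota // nth_iota // add0n.
pose pickG (s : S) : option (wgraph n) :=
  if pselect (exists G, ok s G) is left ex then Some (projT1 (cid ex)) else None.
have pickP G t u : poly G -> exists2 G', pickG (u, wt G u, hist G t u) = Some G' &
    poly G' /\ same_view M t u G' G.
  move=> pG; rewrite /pickG; case: pselect => [ex|[]]; last by exists G; apply: okE.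
  by case: cid => G' /= okG'; exists G' => //; split; [case: okG'|apply: okV okG'].
pose P := @Protocol n S (fun v row => (v, row, [::]))
  (fun s v => if pickG s is Some G then
     (if size s.2 < T then M (size s.2) G s.1.1 v else [::]) else [::])
  (fun s inbox => (s.1.1, s.1.2, rcons s.2 inbox))
  (fun s => if s.1.1 == p then if pickG s is Some G then F G else set0 else set0).
have runE G t u : poly G -> t <= T -> run P G t u = (u, wt G u, hist G t u).
  move=> pG; elim: t u => [|t IHt] u tT //=; rewrite IHt 1?ltnW //=; congr (_, _).
  rewrite /hist -[in RHS]addn1 iotaD map_cat /= cats1 add0n; congr rcons.
  apply/funext=> w; rewrite (IHt w (ltnW tT)) /=.
  have [G' -> [pG' sv]] := pickP G t w pG.
  by rewrite size_map size_iota tT (loc t w G' G).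
have sentE G t u v : poly G -> t < T -> sent P G t u v = M t G u v.
  move=> pG tT; rewrite /sent (runE _ _ _ pG (ltnW tT)) /=.
  have [G' -> [pG' sv]] := pickP G t u pG.
  by rewrite size_map size_iota tT (loc t u G' G).
exists P => G pG; split.
- split=> [t u v msg tT|t u v tT]; rewrite sentE //; [exact: len|exact: one].
- rewrite runE //= eqxx; have [G' -> [pG' sv]] := pickP G T p pG.
  by apply: EF => //; apply: know.
- by move=> v vp; rewrite runE //= (negPf vp).
rewrite /communication -mulnA -[T in T * _]card_ord -sum_nat_const.
apply: leq_sum => -[t tT] _ /=; apply: leq_trans (cost t G tT pG).
by apply: leq_sum => u _; apply: leq_sum => v _; rewrite sentE.
Qed.

End Knowledge.

(** * Hitting sets *)

Section Pairwise.

Variable F : finFieldType.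
Local Notation Q := #|F|.
Implicit Types (X T : {set F}) (x y : F) (p : F * F).

Definition affine p x : F := (p.1 * x + p.2)%R.

Lemma card_affine1 T x : #|[set p | affine p x \in T]| = Q * #|T|.
Proof.
pose f p := (p.1, affine p x).
have f_inj : injective f by move=> [a b] [a' b'] []; rewrite /affine /= => <- /addrI<-.
have -> : [set p | affine p x \in T] = f @^-1: setX setT T by apply/setP=> p; rewrite !inE.
by rewrite card_preimset // cardsX cardsT.
Qed.

(** Pairwise independence: the values at two distinct points determine an affine map. *)
Lemma card_affine2 T x y : x != y ->
  #|[set p | (affine p x \in T) && (affine p y \in T)]| = #|T| ^ 2.
Proof.
move=> xy; pose f p := (affine p x, affine p y).
have f_inj : injective f.
  move=> [a b] [a' b'] []; rewrite /affine /= => e1 e2.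
  have xy0 : (x - y != 0)%R by rewrite subr_eq0.
  have aa : a = a'.
    by apply: (mulIf xy0); rewrite !mulrBr; apply/eqP; rewrite -subr_eq0; apply/eqP;
       transitivity ((a * x + b) - (a' * x + b') - ((a * y + b) - (a' * y + b')))%R;
       [ring|rewrite e1 e2 !subrr].
  by rewrite aa in e1 *; move: e1 => /addrI->.
have -> : [set p | (affine p x \in T) && (affine p y \in T)] = f @^-1: setX T T.
  by apply/setP=> p; rewrite !inE.
by rewrite card_preimset // cardsX mulnn.
Qed.

(* Chebyshev's inequality for the number of elements of [X] sent into [T] by
   a random affine map. *)
Lemma card_affine_miss X T : 0 < #|X| -> 0 < #|T| ->
  #|[set p | [forall x in X, affine p x \notin T]]| * (#|X| * #|T|) <= Q ^ 3.
Proof.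
set miss := [set p | _]; set M := #|X|; set t := #|T| => M0 t0.
pose N p := \sum_(x in X) (affine p x \in T).
have count (P : pred (F * F)) : \sum_p P p = #|[set p | P p]|.
  by rewrite -sum1dep_card [RHS]big_mkcond; apply: eq_bigr => p _; case: (P p).
have sumN : \sum_p N p = M * (Q * t).
  rewrite exchange_big /= (eq_bigr (fun=> Q * t)) => [|x _]; first by rewrite sum_nat_const.
  by rewrite count card_affine1.
have sumN2 : \sum_p N p * N p = M * (Q * t + M.-1 * t ^ 2).
  rewrite (eq_bigr (fun p => \sum_(x in X) \sum_(y in X)
     ((affine p x \in T) && (affine p y \in T)))) => [|p _]; last first.
    rewrite /N big_distrl; apply: eq_bigr => x _; rewrite big_distrr; apply: eq_bigr => y _.
    by case: (affine p x \in T); case: (affine p y \in T).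
  rewrite exchange_big /= (eq_bigr (fun=> Q * t + M.-1 * t ^ 2)) => [|x xX].
    by rewrite sum_nat_const.
  rewrite exchange_big /= (bigD1 x xX) /= count; congr (_ + _).
    by rewrite -(card_affine1 T x); apply: eq_card => p; rewrite !inE andbb.
  rewrite (eq_bigr (fun=> t ^ 2)) => [|y /andP[yX yx]].
    rewrite sum_nat_cond_const; congr (_ * _).
    have -> : [set y in X | y != x] = X :\ x by apply/setP=> y; rewrite !inE andbC.
    by rewrite /M (cardsD1 x X) xX.
  by rewrite count card_affine2 // eq_sym.
(* The variance of [N], multiplied by [Q] inside the square to stay in the integers: the mean of [N]
   is [M * t / Q]. *)
have cheb : (\sum_p (Q%:Z * (N p)%:Z - (M * t)%:Z) ^+ 2 =
    Q%:Z ^+ 3 * (M * t)%:Z - Q%:Z ^+ 2 * (M * t ^ 2)%:Z)%R.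
  rewrite (eq_bigr (fun p => Q%:Z ^+ 2 * (N p * N p)%:Z - Q%:Z * (M * t)%:Z *+ 2 * (N p)%:Z
     + (M * t)%:Z ^+ 2)%R) => [|p _]; last by rewrite PoszM; ring.
  rewrite !big_split /= sumrN -!mulr_sumr -!(big_morph Posz PoszD (erefl _)) sumN sumN2.
  rewrite sumr_const card_prod -mulr_natr !PoszM PoszD !PoszM -[M]prednK //.
  by move: M.-1 => m; rewrite !intS; ring.
have le : (\sum_(p in miss) (M * t)%:Z ^+ 2 <= \sum_p (Q%:Z * (N p)%:Z - (M * t)%:Z) ^+ 2)%R.
  rewrite big_mkcond /=; apply: ler_sum => p _; case: ifP => [|_]; last exact: sqr_ge0.
  rewrite inE => /forall_inP np; rewrite /N big1 => [|x /np/negPf->] //.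
  by rewrite mulr0 sub0r sqrrN.
move: le; rewrite cheb sumr_const -mulr_natr.
have : 0 < M * t by rewrite muln_gt0 M0.
have : M * t <= M * t ^ 2 by rewrite leq_mul2l -mulnn leq_pmulr ?orbT.
move: (M * t) (M * t ^ 2) #|miss| Q => a b s q ab a0 le; nia.
Qed.

End Pairwise.

Lemma exists_subset_card (T : finType) (k : nat) : k <= #|T| -> exists A : {set T}, #|A| = k.
Proof.
move=> kT; exists [set x in take k (enum T)].
by rewrite cardsE (card_uniqP (take_uniq _ (enum_uniq T))) size_takel // -cardE.
Qed.

(* A coordinate of the code of the vertices of [L] takes at least [sqrt #|L| / 2]
   values, and random affine maps behave pairwise independently on these. *)
Lemma hitting_family (n : nat) : exists H : 'I_n -> nat -> {set 'I_n},
  forall i, 0 < i -> 256 ^ i < n ->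
    (forall v, #|[set s | v \in H s i]| * 4 ^ i <= 8 * n) /\
    (forall L : {set 'I_n}, #|L| = 256 ^ i ->
       #|[set s | [disjoint L & H s i]]| * 4 ^ i <= 8 * n).
Proof.
(* Level [i >= 1] presupposes [256 < n], so small [n] is vacuous; [4 <= n] makes the exponent [k]
   below positive. *)
have [n4|n4] := ltnP n 4.
  exists (fun _ _ => set0) => -[//|i] _; rewrite expnS => lt.
  by have := leq_pmulr 256 (expn_gt0 256 i); lia.
have n0 : 0 < n by apply: leq_trans n4.
have /= /andP[] := @trunc_log_bounds 4 n isT n0.
set k := trunc_log 4 n => kn nk.
have k0 : 0 < k by rewrite lt0n; apply: contraTneq nk => ->; rewrite -leqNgt.
(* A field has [Q ^ 2] affine maps and only [n] seeds are available, so [Q] is about the square root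
   of [n]: [Q ^ 2 <= n < 4 * Q ^ 2]. A vertex is therefore coded by two field elements, its two
   lowest digits in base [Q], with at most four vertices to a code. *)
have [F _ cF] := @pPrimePowerField 2 k isT k0.
set Q := 2 ^ k in cF; have Q2 : Q ^ 2 = 4 ^ k by rewrite /Q -expnM mulnC expnM.
rewrite expnS -Q2 in nk; rewrite -Q2 in kn.
have Q0 : 0 < Q by rewrite expn_gt0.
have ex_T i : exists T : {set F}, #|T| == 2 ^ (k - 2 * i).
  suff [T /eqP] : exists T : {set F}, #|T| = 2 ^ (k - 2 * i) by exists T.
  by apply: exists_subset_card; rewrite cF leq_exp2l // leq_subr.
pose el (j : nat) : F := nth 0%R (enum F) (j %% Q).
have el_inj j j' : el j = el j' -> j %% Q = j' %% Q.
  by move/eqP; rewrite nth_uniq ?enum_uniq -?cardE ?cF ?ltn_mod // => /eqP.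
pose xy (v : 'I_n) : F * F := (el v, el (v %/ Q)).
have fib (B : {set F * F}) : #|[set v | xy v \in B]| <= 4 * #|B|.
  pose g (v : 'I_n) : F * F * 'I_4 := (xy v, inord (v %/ Q ^ 2)).
  have g_inj : injective g.
    move=> v w [/el_inj e1 /el_inj e2 /(congr1 val) /=].
    have lt4 (u : 'I_n) : u %/ Q ^ 2 < 4.
      by rewrite ltn_divLR ?expn_gt0 ?Q0 // (leq_trans (ltn_ord u)) // ltnW.
    rewrite !inordK // -mulnn !divnMA => e3; apply: val_inj => /=.
    by rewrite (divn_eq v Q) (divn_eq w Q) e1 (divn_eq (v %/ Q) Q) (divn_eq (w %/ Q) Q) e2 e3.
  rewrite -(card_imset _ g_inj); have -> : 4 * #|B| = #|setX B [set: 'I_4]|.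
    by rewrite cardsX cardsT card_ord mulnC.
  apply: subset_leq_card; apply/subsetP=> _ /imsetP[v vB ->].
  by rewrite inE in vB; rewrite !inE vB.
have [T cT] : exists T : nat -> {set F}, forall i, #|T i| = 2 ^ (k - 2 * i).
  by exists (fun i => xchoose (ex_T i)) => i; apply/eqP/(xchooseP (ex_T i)).
(* The seed is read as an affine map and [v] as two points; [v] is selected when either point lands
   in [T i], a set of density [4 ^ -i]. *)
pose H s i := [set v | (affine (xy s) (xy v).1 \in T i) || (affine (xy s) (xy v).2 \in T i)].
exists H => i i0 lti.
(* This keeps the exponent [k - 2 * i] in the size of [T i] from being truncated. *)
have ik : 2 * i <= k.
  have : 256 ^ i < 4 ^ k.+1 by rewrite expnS -Q2 (ltn_trans lti).
  by rewrite -[256]/(2 ^ 8) -[4]/(2 ^ 2) -!expnM ltn_exp2l //; lia.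
set t := #|T i|; have t4 : t * 4 ^ i = Q.
  by rewrite /t cT -[4]/(2 ^ 2) -expnM -expnD subnK.
have t0 : 0 < t by rewrite /t cT expn_gt0.
split=> [v|L cL].
  have : #|[set s | v \in H s i]| <= 4 * (2 * (Q * t)).
    have sub : [set s | v \in H s i] \subset
        [set s | xy s \in [set p | (affine p (xy v).1 \in T i) || (affine p (xy v).2 \in T i)]].
      by apply/subsetP=> s; rewrite !inE.
    apply: leq_trans (subset_leq_card sub) (leq_trans (fib _) _).
    rewrite leq_mul2l /= mul2n -addnn.
    have h x := card_affine1 (T i) x; rewrite cF in h.
    rewrite -{1}(h (xy v).1) -(h (xy v).2).
    apply: leq_trans (leq_card_setU _ _); apply: subset_leq_card.
    by apply/subsetP=> p; rewrite !inE.
  move=> h; apply: leq_trans (leq_mul h (leqnn (4 ^ i))) _.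
  have -> : 4 * (2 * (Q * t)) * 4 ^ i = 8 * (Q * (t * 4 ^ i)) by lia.
  by rewrite t4 mulnn leq_mul2l.
pose X := [set (xy v).1 | v in L]; pose Y := [set (xy v).2 | v in L].
have cXY : 256 ^ i <= 4 * (#|X| * #|Y|).
  rewrite -cL -cardsX; apply: leq_trans (fib _); apply: subset_leq_card.
  by apply/subsetP=> v vL; rewrite !inE; apply/andP; split; apply/imsetP; exists v.
(* The origin of 256: one coordinate sees only the square root of [#|L|], so [256 = 16 ^ 2]; of
   [16 = 4 * 4], one factor pays for the density of [T i] and the other is the required gain. *)
have miss (Z : {set F}) : 16 ^ i <= 2 * #|Z| ->
    #|[set p | [forall x in Z, affine p x \notin T i]]| * 4 ^ i <= 2 * Q ^ 2.
  move=> cZ; have Z0 : 0 < #|Z| by have := expn_gt0 16 i; lia.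
  have := card_affine_miss Z0 t0; rewrite cF -/t; set m := #|[set p | _]| => hm.
  have e16 : 16 ^ i = 4 ^ i * 4 ^ i by rewrite -expnMn.
  have p4 : 0 < 4 ^ i by rewrite expn_gt0.
  have h1 : m * #|Z| <= Q ^ 2 * 4 ^ i.
    rewrite -(leq_pmul2r Q0).
    have -> : m * #|Z| * Q = m * (#|Z| * t) * 4 ^ i by rewrite -[X in _ * X = _]t4; lia.
    have -> : Q ^ 2 * 4 ^ i * Q = Q ^ 3 * 4 ^ i by rewrite (expnS Q 2); lia.
    by rewrite leq_mul2r hm orbT.
  rewrite -(leq_pmul2r p4) -mulnA -e16; apply: leq_trans (leq_mul (leqnn m) cZ) _; lia.
have goal (Z : {set F}) : 16 ^ i <= 2 * #|Z| ->
    (forall s, [disjoint L & H s i] -> forall x, x \in Z -> affine (xy s) x \notin T i) ->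
    #|[set s | [disjoint L & H s i]]| * 4 ^ i <= 8 * n.
  move=> /miss hZ sub; have : #|[set s | [disjoint L & H s i]]| <=
      4 * #|[set p | [forall x in Z, affine p x \notin T i]]|.
    apply: leq_trans (fib _); apply: subset_leq_card; apply/subsetP=> s; rewrite !inE => /sub h.
    exact/forall_inP.
  set m := #|_|; set m' := #|_| in hZ * => h.
  by apply: leq_trans (leq_mul h (leqnn (4 ^ i))) _; lia.
have [hX|hX] := leqP (16 ^ i) (2 * #|X|).
  apply: (goal X hX) => s /pred0P dis x /imsetP[v vL ->].
  by have := dis v; rewrite /= vL inE /= => /negbT; rewrite negb_or => /andP[].
apply: (goal Y) => [|s /pred0P dis x /imsetP[v vL ->]].
  rewrite leqNgt; apply/negP=> hY; have e256 : 256 ^ i = 16 ^ i * 16 ^ i by rewrite -expnMn.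
  nia.
by have := dis v; rewrite /= vL inE /= => /negbT; rewrite negb_or => /andP[].
Qed.

(** * Ranks, clusters and batches *)

Lemma card_le_inj (T : finType) (S : {set T}) (f : T -> nat) (b : nat) :
  {in S &, injective f} -> (forall x, x \in S -> f x < b) -> #|S| <= b.
Proof.
case: b => [|b] f_inj fb.
  by rewrite leqn0 cards_eq0; apply/set0Pn => -[x /fb].
rewrite -[b.+1]card_ord -(@card_in_imset _ _ (fun x => inord (f x) : 'I_b.+1)).
  exact: max_card.
by move=> x y xS yS /(congr1 val) /=; rewrite !inordK ?fb //; apply: f_inj.
Qed.

Section Order.

Variables (T : finType) (key : T -> int) (A : {set T}).
Hypothesis key_inj : {in A &, injective key}.

Definition place x := #|[set y in A | (key y < key x)%R]|.

Lemma place_lt x y : x \in A -> y \in A -> (place x < place y) = (key x < key y)%R.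
Proof.
have mono u v : u \in A -> (key u < key v)%R -> place u < place v.
  move=> uA uv; apply: proper_card; apply/properP; split.
    by apply/subsetP=> z; rewrite !inE => /andP[-> /lt_trans->].
  by exists u; rewrite !inE uA ?uv // ltxx.
move=> xA yA; apply/idP/idP; last exact: mono.
case: (ltgtP (key x) (key y)) => // [yx|/(key_inj xA yA)->]; last by rewrite ltnn.
by rewrite ltnNge ltnW // mono.
Qed.

Lemma place_inj : {in A &, injective place}.
Proof.
move=> x y xA yA pxy; apply: key_inj => //.
have := place_lt xA yA; have := place_lt yA xA; rewrite pxy ltnn.
by case: ltgtP.
Qed.

Lemma place_card x : x \in A -> place x < #|A|.
Proof.
move=> xA; apply: proper_card; apply/properP; split.
  by apply/subsetP=> z; rewrite inE => /andP[].
by exists x; rewrite // inE ltxx andbF.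
Qed.

Lemma card_place k : k <= #|A| -> #|[set x in A | place x < k]| = k.
Proof.
move=> kA; apply/eqP; rewrite eqn_leq; apply/andP; split.
  apply: (card_le_inj (f := place)) => [x y|x]; rewrite !inE.
    by move=> /andP[xA _] /andP[yA _]; apply: place_inj.
  by case/andP.
have : #|A :\: [set x in A | place x < k]| <= #|A| - k.
  apply: (card_le_inj (f := fun x => place x - k)) => [x y|x]; rewrite !inE.
    move=> /andP[+ xA] /andP[+ yA]; rewrite xA yA /= -!leqNgt => kx ky e.
    by apply: place_inj => //; lia.
  by case/andP=> + xA; rewrite xA /= -leqNgt => kx; have := place_card xA; lia.
rewrite cardsD (setIidPr _); last by apply/subsetP=> x; rewrite inE => /andP[].
by lia.
Qed.

End Order.

(** * Ranks of edges as seen from their ends *)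

Section Local.

Variable n : nat.
Implicit Types (G : wgraph n) (row : 'I_n -> option int) (u v w x : 'I_n).

Definition norm v w : 'I_n * 'I_n := if v < w then (v, w) else (w, v).

Lemma norm_inj v : injective (norm v).
Proof.
by move=> w w'; rewrite /norm; do 2!case: ifP => _; case=> // *; congruence.
Qed.

Lemma normC v w : norm v w = norm w v.
Proof.
by rewrite /norm; case: (ltngtP v w) => // /val_inj->.
Qed.

Lemma norm_ends v w : norm v w = (v, w) \/ norm v w = (w, v).
Proof. by rewrite /norm; case: ifP; auto. Qed.

Definition nbrs row := [set x | isSome (row x)].

(** The key of an edge computed from one row alone, so that a player can rank its own edges;
    [row_keyE] identifies it with [key]. *)
Definition row_key row v w : int :=
  (odflt 0 (row w) * (n ^ 4).+1%:Z + (idx (norm v w))%:Z)%R.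

Definition rank row v w : nat := place (row_key row v) (nbrs row) w.

Lemma nbrsE G v w : (w \in nbrs (G v)) = isSome (G v w).
Proof. by rewrite inE. Qed.

Lemma nbrs_sym G v w : (w \in nbrs (G v)) = (v \in nbrs (G w)).
Proof. by rewrite !inE wt_sym. Qed.

Lemma row_keyE G v w : row_key (G v) v w = key G (norm v w).
Proof.
rewrite /row_key /key; case: (norm_ends v w) => -> //=.
by rewrite wt_sym.
Qed.

Lemma row_key_inj G v : injective (row_key (G v) v).
Proof. by move=> w w'; rewrite !row_keyE => /key_inj/norm_inj. Qed.

Lemma norm_edge G v w : w \in nbrs (G v) -> norm v w \in edges G.
Proof.
rewrite nbrsE /norm => Gvw; rewrite inE; case: (ltngtP v w) => [vw|wv|/val_inj vw] /=.
- by rewrite vw.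
- by rewrite wv wt_sym.
- by move: Gvw; rewrite vw wt_irr.
Qed.

Lemma edge_norm G e : e \in edges G -> norm e.1 e.2 = e /\ e.2 \in nbrs (G e.1).
Proof. by case: e => a b; rewrite !inE /norm /= => /andP[-> ->]. Qed.

Lemma rank_lt G v w : w \in nbrs (G v) -> rank (G v) v w < #|nbrs (G v)|.
Proof. exact: place_card. Qed.

Lemma rank_inj G v : {in nbrs (G v) &, injective (rank (G v) v)}.
Proof. by apply: place_inj => x y _ _; apply: row_key_inj. Qed.

Lemma nbrs_lt G v : #|nbrs (G v)| < n.
Proof.
rewrite -[X in _ < X]card_ord -cardsT; apply: proper_card.
rewrite properT; apply: contraTneq (in_setT v) => <-.
by rewrite nbrsE wt_irr.
Qed.

Lemma rank_ltn G v w : w \in nbrs (G v) -> rank (G v) v w < n.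
Proof. by move=> /rank_lt/ltn_trans->//; apply: nbrs_lt. Qed.

Definition near row v i := [set x in nbrs row | rank row v x < 256 ^ i].

Lemma card_near G v i : 256 ^ i < #|nbrs (G v)| -> #|near (G v) v i| = 256 ^ i.
Proof.
by move=> lt; apply: card_place; [move=> x y _ _; apply: row_key_inj|apply: ltnW].
Qed.

Definition edge_rank G v w := minn (rank (G v) v w) (rank (G w) w v).

Lemma edge_rankC G v w : edge_rank G v w = edge_rank G w v.
Proof. by rewrite /edge_rank minnC. Qed.

Definition erank G e := edge_rank G e.1 e.2.

Lemma erank_norm G v w : erank G (norm v w) = edge_rank G v w.
Proof. by rewrite /erank; case: (norm_ends v w) => -> //=; rewrite edge_rankC. Qed.

Lemma erank_lt G e : e \in edges G -> erank G e < n.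
Proof.
move=> /edge_norm[_ e12]; rewrite gtn_min rank_ltn //.
Qed.

(** All ranks below 256, including rank 0, have level 0, where nothing is contracted. *)
Definition level r := trunc_log 256 r.

Lemma level_le r : 0 < level r -> 256 ^ level r <= r.
Proof. by move=> l0; apply: trunc_logP => //; case: r l0. Qed.

Lemma level_lt r : r < 256 ^ (level r).+1.
Proof. by apply: trunc_log_ltn. Qed.

Lemma level_n r : r < n -> 0 < level r -> 256 ^ level r < n.
Proof. by move=> rn /level_le h; apply: leq_ltn_trans rn. Qed.

(** * Clusters and the averaging over seeds *)

Section Clusters.

Variable H : 'I_n -> nat -> {set 'I_n}.

(** A vertex without a near neighbour in [H s i] stays alone, as does every vertex at level 0. *)
Definition cluster s row v i : 'I_n :=
  if i == 0 then v else odflt v [pick x in near row v i :&: H s i].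

Definition unhit s row v i : bool :=
  (256 ^ i < #|nbrs row|) && [disjoint near row v i & H s i].

Lemma cluster_conn G s e x : e \in edges G -> x = e.1 \/ x = e.2 ->
  conn (lighter (key G) (edges G) e) x (cluster s (G x) x (level (erank G e))).
Proof.
move=> eE ex; rewrite /cluster; case: eqP => [_|/eqP]; first exact: conn_refl.
rewrite -lt0n => l0; case: pickP => [u|_] /=; last exact: conn_refl.
rewrite !inE => /andP[/andP[Gxu ru] _].
have [y [yx exy]] : exists y, y \in nbrs (G x) /\ norm x y = e.
  have [en e12] := edge_norm eE; case: ex => ->; first by exists e.2.
  by exists e.1; rewrite nbrs_sym normC.
have rxy : rank (G x) x u < rank (G x) x y.
  apply: leq_trans ru (leq_trans (level_le l0) _).
  by rewrite -exy erank_norm geq_minl.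
have uN : u \in nbrs (G x) by rewrite inE.
have : norm x u \in lighter (key G) (edges G) e.
  rewrite inE norm_edge //= -exy -!row_keyE.
  rewrite /rank place_lt // in rxy; by move=> a b _ _; apply: row_key_inj.
by move/conn_edge; case: (norm_ends x u) => -> //=; rewrite conn_sym.
Qed.

(** At either end the rank of [e] is at least [256 ^ i] for its level [i], so that end has more than
    [256 ^ i] neighbours. Vertices of smaller degree, which [unhit] does not count, therefore never
    occur as ends in this level. *)
Lemma cluster_in G s e x : e \in edges G -> x = e.1 \/ x = e.2 ->
    0 < level (erank G e) ->
  cluster s (G x) x (level (erank G e)) \in
    H s (level (erank G e)) :|: [set v | unhit s (G v) v (level (erank G e))].
Proof.
move=> eE ex l0; rewrite /cluster; rewrite eqn0Ngt l0 /=.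
case: pickP => [u|nu] /=; first by rewrite !inE => /andP[_ ->].
rewrite !inE; apply/orP; right; rewrite /unhit; apply/andP; split; last first.
  by apply/pred0P => u; have := nu u; rewrite /= inE.
apply: leq_ltn_trans (level_le l0) _.
have [_ e12] := edge_norm eE.
by rewrite /erank /edge_rank gtn_min; case: ex => ->; rewrite rank_lt ?orbT // nbrs_sym.
Qed.

(** The potential to be minimised is the number of clusters, weighted by [2 ^ i]. It splits into
    [base], which does not depend on the graph, and one term per vertex that depends on the row of
    that vertex only. *)
Definition cost s row v := \sum_(i < n | 0 < i) 2 ^ i * unhit s row v i.

Definition base s := \sum_(i < n | (0 < i) && (256 ^ i < n)) 2 ^ i * #|H s i|.

Definition csum G s := \sum_v cost s (G v) v.

Hypothesis H_hitting : forall i, 0 < i -> 256 ^ i < n ->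
  (forall v, #|[set s | v \in H s i]| * 4 ^ i <= 8 * n) /\
  (forall L : {set 'I_n}, #|L| = 256 ^ i ->
     #|[set s | [disjoint L & H s i]]| * 4 ^ i <= 8 * n).

Definition nclus G s i := #|H s i| + #|[set v | unhit s (G v) v i]|.

Lemma sum_card_swap (T U : finType) (P : T -> U -> bool) :
  \sum_x #|[set y | P x y]| = \sum_y #|[set x | P x y]|.
Proof.
transitivity (\sum_x \sum_y P x y).
  by apply: eq_bigr => x _; rewrite -sum1dep_card big_mkcond; apply: eq_bigr => y _; case: P.
rewrite exchange_big; apply: eq_bigr => y _ /=.
by rewrite -sum1dep_card [RHS]big_mkcond; apply: eq_bigr => x _; case: P.
Qed.

(** Double counting of pairs of a seed and a vertex: each vertex is selected by few seeds, and few
    seeds leave it unhit. *)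
Lemma sum_nclus G i : 0 < i -> 256 ^ i < n ->
  (\sum_s nclus G s i) * 4 ^ i <= 16 * n ^ 2.
Proof.
move=> i0 lt; have [H1 H2] := H_hitting i0 lt.
rewrite big_split /= mulnDl.
have -> : \sum_s #|H s i| = \sum_v #|[set s | v \in H s i]|.
  rewrite -(sum_card_swap (fun s v => v \in H s i)).
  by apply: eq_bigr => s _; apply: eq_card => v; rewrite !inE.
rewrite (sum_card_swap (fun s v => unhit s (G v) v i)) !big_distrl /=.
have le8 (f : 'I_n -> nat) : (forall v, f v <= 8 * n) -> \sum_v f v <= 8 * n ^ 2.
  move=> fv; apply: leq_trans (leq_sum _ (fun v _ => fv v)) _.
  by rewrite sum_nat_const card_ord -mulnn; lia.
have -> : 16 * n ^ 2 = 8 * n ^ 2 + 8 * n ^ 2 by lia.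
apply: leq_add; apply: le8 => // v.
have [act|nact] := boolP (256 ^ i < #|nbrs (G v)|).
  apply: leq_trans (H2 _ (card_near act)); rewrite leq_mul2r.
  by apply/orP; right; apply: subset_leq_card; apply/subsetP=> s; rewrite !inE => /andP[].
rewrite [X in X * _](_ : _ = 0) //; apply/eqP; rewrite cards_eq0.
by apply/eqP/setP=> s; rewrite !inE /unhit (negPf nact).
Qed.

Lemma cost_nclus G s : base s + csum G s =
  \sum_(i < n | (0 < i) && (256 ^ i < n)) 2 ^ i * nclus G s i.
Proof.
under [RHS]eq_bigr do rewrite mulnDr.
rewrite big_split /=; congr (_ + _).
rewrite /csum exchange_big [RHS]big_mkcondr /=.
apply: eq_bigr => i _; rewrite -big_distrr /=.
have -> : \sum_v (unhit s (G v) v i : nat) = #|[set v | unhit s (G v) v i]|.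
  by rewrite -sum1dep_card [RHS]big_mkcond; apply: eq_bigr => v _; case: unhit.
(* At levels with [n <= 256 ^ i] no vertex has more than [256 ^ i] neighbours, so [csum] has no
   further terms. *)
case: ifP => // lt; rewrite [X in _ * X](_ : _ = 0) ?muln0 //.
apply/eqP; rewrite cards_eq0; apply/eqP/setP=> v; rewrite !inE /unhit.
by case: ltnP => // h; rewrite (ltn_trans h (nbrs_lt G v)) in lt.
Qed.

Lemma geometric_sum m : \sum_(i < m) 2 ^ (m - i) < 2 ^ m.+1.
Proof.
elim: m => [|m IHm]; first by rewrite big_ord0.
rewrite big_ord_recl subn0 [X in _ < X]expnS mul2n -addnn ltn_add2l.
by under eq_bigr do rewrite lift0 subSS.
Qed.

(** Averaging: summed over the [n] seeds, level [i] contributes at most [16 * n ^ 2 / 2 ^ i], and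
    these terms, starting at [i = 1], add up to less than [16 * n ^ 2]. *)
Lemma exists_good_seed G : 0 < n -> exists s, base s + csum G s <= 16 * n.
Proof.
move=> n0; have [/existsP//|] := boolP [exists s, base s + csum G s <= 16 * n].
rewrite negb_exists => /forallP bad; exfalso.
have : n * (16 * n).+1 <= \sum_s (base s + csum G s).
  rewrite -[X in X * _]card_ord -sum_nat_const; apply: leq_sum => s _.
  by rewrite ltnNge bad.
apply/negP; rewrite -ltnNge.
have n20 : 0 < 16 * n ^ 2 by rewrite muln_gt0 expn_gt0 n0.
have -> : n * (16 * n).+1 = 16 * n ^ 2 + n by rewrite -mulnn; lia.
under eq_bigr do rewrite cost_nclus.
rewrite exchange_big /=; under eq_bigr do rewrite -big_distrr /=.
have p2 : 0 < 2 ^ n by rewrite expn_gt0.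
(* The factor [2 ^ n] turns the series of the [2 ^ -i] into a sum of natural numbers. *)
rewrite -(ltn_pmul2l p2) big_distrr /=.
apply: (@leq_ltn_trans (\sum_(i < n | 0 < i) 16 * n ^ 2 * 2 ^ (n - i))).
  rewrite big_mkcondr /=; apply: leq_sum => i i0; case: ifP => // lt.
  have := sum_nclus G i0 lt; set N := \sum_s _ => hN.
  have -> : 2 ^ n * (2 ^ i * N) = N * 4 ^ i * 2 ^ (n - i).
    have -> : 2 ^ n = 2 ^ i * 2 ^ (n - i) by rewrite -expnD subnKC // ltnW.
    by rewrite -[4]/(2 * 2) expnMn; lia.
  by rewrite leq_mul2r hN orbT.
rewrite -big_distrr /=; apply: (@leq_trans (2 ^ n * (16 * n ^ 2))).
  rewrite mulnC ltn_pmul2r // big_mkcond /=.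
  case: (n) n0 => // m _; rewrite big_ord_recl /= add0n.
  by under eq_bigr do rewrite subSS; apply: geometric_sum.
by rewrite leq_mul2l leq_addr orbT.
Qed.

End Clusters.
End Local.

Lemma index_enum_inj (T : finType) (A : {set T}) : {in A &, injective (index^~ (enum A))}.
Proof.
move=> x y xA yA ixy; have nx : nth x (enum A) (index x (enum A)) = x.
  by rewrite nth_index ?mem_enum.
by rewrite -[LHS]nx ixy nth_index ?mem_enum.
Qed.

Lemma divmod_inj d m m' : m %/ d = m' %/ d -> m %% d = m' %% d -> m = m'.
Proof. by move=> e1 e2; rewrite (divn_eq m d) e1 e2 -divn_eq. Qed.

(** Dealing out [A] cyclically to [a] players; this balances the load of the intermediate
    players. *)
Lemma card_residue (T : finType) (A : {set T}) (a l b : nat) : #|A| <= b * a ->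
  #|[set e in A | index e (enum A) %% a == l]| <= b.
Proof.
move=> cA; apply: (card_le_inj (f := fun e => index e (enum A) %/ a)) => [x y|x].
  rewrite !inE => /andP[xA /eqP xl] /andP[yA /eqP yl] /divmod_inj.
  by rewrite xl yl => /(_ erefl)/index_enum_inj; apply.
rewrite inE => /andP[xA _]; have : index x (enum A) < b * a.
  by apply: leq_trans cA; rewrite cardE index_mem mem_enum.
by case: (posnP a) => [->|a0]; [rewrite muln0|rewrite ltn_divLR].
Qed.

Lemma radix_inj b q r q' r' : r < b -> r' < b -> q * b + r = q' * b + r' ->
  q = q' /\ r = r'.
Proof.
move=> rb rb' eqs; have b0 := leq_ltn_trans (leq0n r) rb.
have := congr1 (divn^~ b) eqs; have := congr1 (modn^~ b) eqs.
by rewrite !modnMDl !divnMDl // !modn_small // !divn_small // !addn0.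
Qed.

(** * Repeated filtering and merging of batches, and the loads it causes *)

Section Filter.

Variables (n : nat) (H : 'I_n -> nat -> {set 'I_n}) (p0 : 'I_n) (seed : wgraph n -> 'I_n).
Hypothesis seed_good : forall G, base H (seed G) + csum H G (seed G) <= 16 * n.
Implicit Types (G : wgraph n) (e : 'I_n * 'I_n) (h : 'I_n).

(** The number of the player holding the edges of rank [r] after [j] merges: the lowest
    [level r * j] bits are cleared, [level r] more of them in each merge. *)
Definition hold j r := r %/ 2 ^ (level r * j) * 2 ^ (level r * j).

Lemma hold_le j r : hold j r <= r.
Proof. exact: leq_trunc_div. Qed.

Lemma hold0 r : hold 0 r = r.
Proof. by rewrite /hold muln0 divn1 muln1. Qed.

(** For [j <= 8] the power [256 ^ level r] is a multiple of [2 ^ (level r * j)], so rounding down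
    does not pass it. *)
Lemma level_hold j r : j <= 8 -> level (hold j r) = level r.
Proof.
move=> j8; have [l0|l0] := posnP (level r).
  by rewrite /hold l0 mul0n divn1 muln1.
apply: trunc_log_eq => //; rewrite (leq_ltn_trans (hold_le _ _) (level_lt _)) andbT.
have -> : 256 ^ level r = 2 ^ (level r * (8 - j)) * 2 ^ (level r * j).
  by rewrite -expnD -mulnDr subnK // -[256]/(2 ^ 8) -expnM mulnC.
rewrite leq_mul2r; apply/orP; right; rewrite leq_divRL ?expn_gt0 // -expnD -mulnDr subnK //.
by rewrite mulnC expnM; apply: level_le.
Qed.

Lemma hold_hold j r : j <= 8 -> hold j.+1 (hold j r) = hold j.+1 r.
Proof.
move=> j8; rewrite /hold level_hold //; congr (_ * _).
by rewrite mulnS addnC expnD !divnMA mulnK // expn_gt0.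
Qed.

Definition seed_cluster G i v := cluster H (seed G) (G v) v i.

Fixpoint alive_at G j : edge_set n :=
  if j is j'.+1 then \bigcup_(h : 'I_n) survivors (key G) (seed_cluster G (level h))
    [set e in alive_at G j' | hold j' (erank G e) == h]
  else edges G.

#[global] Arguments alive_at : simpl never.

Definition held_at G j h := [set e in alive_at G j | hold j (erank G e) == h].

Definition kept_at G j h := survivors (key G) (seed_cluster G (level h)) (held_at G j h).

Lemma aliveS G j : alive_at G j.+1 = \bigcup_h kept_at G j h.
Proof. by []. Qed.

Lemma kept_grp G j h e : e \in kept_at G j h -> e \in held_at G j h.
Proof. by rewrite inE => /andP[]. Qed.

Lemma kept_hold G j h e : e \in kept_at G j h -> hold j (erank G e) = h.
Proof. by move/kept_grp; rewrite inE => /andP[_ /eqP]. Qed.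

Lemma alive_edge G j e : e \in alive_at G j -> e \in edges G.
Proof.
elim: j => [//|j IHj]; rewrite aliveS => /bigcupP[h _ /kept_grp].
by rewrite inE => /andP[/IHj].
Qed.

Lemma kept_edge G j h e : e \in kept_at G j h -> e \in edges G.
Proof. by move/kept_grp; rewrite inE => /andP[/alive_edge]. Qed.

Lemma grp_edge G j h e : e \in held_at G j h -> e \in edges G.
Proof. by rewrite inE => /andP[/alive_edge]. Qed.

(** Batches are disjoint, so forwarding all survivors costs at most one message per edge. *)
Lemma kept_sum G j : \sum_h #|kept_at G j h| <= #|edges G|.
Proof.
have -> : \sum_h #|kept_at G j h| = \sum_(h < n) #|[set e in alive_at G j.+1 | hold j (erank G e) == h]|.
  apply: eq_bigr => h _; apply: eq_card => e; rewrite [RHS]inE aliveS.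
  apply/idP/andP => [eh|[/bigcupP[h' _ eh'] /eqP eh]].
    by split; [apply/bigcupP; exists h|rewrite (kept_hold eh)].
  by have <- : h' = h by apply: val_inj; rewrite /= -eh (kept_hold eh').
rewrite (sum_card_swap (fun h e => (e \in alive_at G j.+1) && (hold j (erank G e) == h))).
apply: (@leq_trans #|alive_at G j.+1|); last first.
  by apply/subset_leq_card/subsetP=> e /alive_edge.
rewrite -sum1_card [X in _ <= X]big_mkcond; apply: leq_sum => e _; case: ifP => eA.
  apply: (@leq_trans #|[set h : 'I_n | hold j (erank G e) == h]|).
    by apply/subset_leq_card/subsetP=> h; rewrite !inE => /andP[].
  apply: (card_le_inj (f := fun=> 0)) => // h h'; rewrite !inE => /eqP eh /eqP eh' _.
  by apply: val_inj; rewrite /= -eh -eh'.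
by rewrite leqn0 cards_eq0; apply/eqP/setP=> h; rewrite !inE.
Qed.

(** Nine filterings are allowed, for the groupings [hold 0] to [hold 8]; up to there the level of
    the holder is the level of its edges. *)
Lemma msf_alive G j : j <= 9 -> msf (key G) (edges G) \subset alive_at G j.
Proof.
elim: j => [|j IHj] j9; first exact: msf_sub.
apply/subsetP=> e eM; have eA := subsetP (IHj (ltnW j9)) e eM.
have en : hold j (erank G e) < n.
  exact: leq_ltn_trans (hold_le _ _) (erank_lt (alive_edge eA)).
rewrite aliveS; apply/bigcupP; exists (Ordinal en) => //.
have eg : e \in held_at G j (Ordinal en) by rewrite inE eA /=.
apply: (msf_survivors _ _ eg eM) => [|f].
  by apply/subsetP=> f; rewrite inE => /andP[/alive_edge].
move=> fg; have fE := grp_edge fg; move: fg; rewrite inE => /andP[_ /eqP /= <-].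
by rewrite level_hold //; split; apply: cluster_conn; auto.
Qed.

Lemma nclus_bound G i : 0 < i -> 256 ^ i < n -> 2 ^ i * nclus H G (seed G) i <= 16 * n.
Proof.
move=> i0 lt; apply: leq_trans (seed_good G); rewrite cost_nclus.
have iN : i < n by apply: leq_ltn_trans lt; rewrite ltnW // ltn_expl.
by rewrite (bigD1 (Ordinal iN)) /= ?i0 //= leq_addr.
Qed.

Definition slots h := n %/ 2 ^ level h.

Lemma slots_gt0 h : 0 < slots h.
Proof.
have n0 : 0 < n by apply: leq_ltn_trans (ltn_ord h).
rewrite divn_gt0 ?expn_gt0 //; have [->//|l0] := posnP (level h).
apply: leq_trans (ltnW (level_n (ltn_ord h) l0)).
by rewrite leq_exp2r.
Qed.

(** The good seed leaves at most [16 * n / 2 ^ level h] clusters; the constant doubles because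
    [slots h] is a quotient rounded down, but positive. *)
Lemma card_kept G j h : j <= 8 -> #|kept_at G j h| <= 32 * slots h.
Proof.
move=> j8; have [->|/set0Pn[e0 e0g]] := eqVneq (kept_at G j h) set0; first by rewrite cards0.
have lvl e : e \in held_at G j h -> level h = level (erank G e).
  by rewrite inE => /andP[_ /eqP <-]; rewrite level_hold.
have [l0|l0] := posnP (level h).
  rewrite /slots l0 divn1; apply: leq_trans (card_survivors (@key_inj _ G) (V := setT) _) _.
  - by move=> e _; rewrite !inE.
  - by rewrite cardsT card_ord leq_pmull.
have lt : 256 ^ level h < n by apply: level_n.
apply: leq_trans (card_survivors (@key_inj _ G) (V := H (seed G) (level h) :|: [set v | unhit H (seed G) (G v) v (level h)]) _) _.
  move=> e eg; rewrite /seed_cluster (lvl e eg); have eE := grp_edge eg.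
  by rewrite (lvl e eg) in l0; split; apply: cluster_in; auto.
apply: leq_trans (leq_card_setU _ _) _; have := nclus_bound G l0 lt.
rewrite -/(nclus H G (seed G) (level h)) /slots => hb.
have a0 := slots_gt0 h; rewrite /slots in a0; set a := n %/ _ in a0 *.
have : n < a.+1 * 2 ^ level h by rewrite -ltn_divLR // expn_gt0.
set N := nclus _ _ _ _ in hb *; have : 0 < 2 ^ level h by rewrite expn_gt0.
move: (2 ^ level h) hb => b hb b0 hn; rewrite leqNgt; apply/negP=> hN; nia.
Qed.

(* In merge [j] the holders [h] of one group get consecutive blocks of [slots h]
   intermediate players; [merge_mid] spreads the items of [h] over its block. *)
Definition merge_mid j (A : edge_set n) h e : nat :=
  (h %/ 2 ^ (level h * j)) %% 2 ^ level h * slots h + index e (enum A) %% slots h.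

Lemma merge_mid_lt j A h e : merge_mid j A h e < n.
Proof.
have a0 := slots_gt0 h; have := ltn_pmod (index e (enum A)) a0.
have : (h %/ 2 ^ (level h * j)) %% 2 ^ level h < 2 ^ level h by rewrite ltn_mod expn_gt0.
have := leq_trunc_div n (2 ^ level h); rewrite -/(slots h) /merge_mid.
set q := (h %/ _) %% _; set l := index e _ %% _; move: q l (slots h) => q l a.
by move: (2 ^ level h) => b; nia.
Qed.

Lemma merge_mid_src G j h w : j <= 8 ->
  #|[set e in kept_at G j h | insubd p0 (merge_mid j (kept_at G j h) h e) == w]| <= 32.
Proof.
move=> j8; apply: leq_trans (card_residue (w %% slots h) (card_kept G h j8)).
apply/subset_leq_card/subsetP=> e; rewrite !inE -!/(kept_at _ _ _) => /andP[-> /eqP <-] /=.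
rewrite val_insubd merge_mid_lt /merge_mid modnMDl modn_mod; exact: eqxx.
Qed.

(** The pair of [w] and [g] determines the holder: [g] gives its level and high bits, and the block
    containing [w] gives the [level h] bits lost in this merge. So only one batch contributes, and
    [card_residue] applies. *)
Lemma merge_mid_dst G j w g : j < 8 ->
  #|\bigcup_h [set e in kept_at G j h | (insubd p0 (merge_mid j (kept_at G j h) h e) == w)
      && (insubd p0 (hold j.+1 (erank G e)) == g)]| <= 32.
Proof.
move=> j8; set S := \bigcup_h _; have [->|/set0Pn[e0 e0S]] := eqVneq S set0.
  by rewrite cards0.
have SP e : e \in S -> exists h : 'I_n, [/\ e \in kept_at G j h, merge_mid j (kept_at G j h) h e = w
    & hold j.+1 h = g].
  case/bigcupP=> h _; rewrite inE => /and3P[ek /eqP <- /eqP <-]; exists h; split=> //.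
    by rewrite val_insubd merge_mid_lt.
  rewrite val_insubd (leq_ltn_trans (hold_le _ _) (erank_lt (kept_edge ek))).
  by rewrite -(kept_hold ek) hold_hold // ltnW.
have block h e : e \in kept_at G j h -> hold j h = h.
  move=> ek; rewrite -(kept_hold ek) {1}/hold level_hold 1?ltnW //.
  by rewrite /hold mulnK ?expn_gt0.
have [h0 [e0k e0w e0g]] := SP e0 e0S.
apply: leq_trans (card_residue (w %% slots h0) (card_kept G h0 (ltnW j8))).
apply/subset_leq_card/subsetP=> e /SP[h [ek ew eg]].
have lh : level h = level h0.
  by rewrite -(level_hold h j8) eg -e0g level_hold.
have a0 := slots_gt0 h0.
have sh : slots h = slots h0 by rewrite /slots lh.
have eh : h = h0.
  apply: val_inj; rewrite /= -(block h e ek) -(block h0 e0 e0k) /hold lh; congr (_ * _).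
  have : hold j.+1 h = hold j.+1 h0 by rewrite eg e0g.
  rewrite /hold lh mulnS addnC expnD !divnMA => /eqP.
  rewrite eqn_pmul2r ?muln_gt0 ?expn_gt0 // => /eqP hq.
  have := congr1 (divn^~ (slots h0)) ew; have := congr1 (divn^~ (slots h0)) e0w.
  rewrite /merge_mid sh lh !divnMDl // !(divn_small (ltn_pmod _ a0)) !addn0 => q1 q2.
  by rewrite (divn_eq (h %/ _) (2 ^ level h0)) (divn_eq (h0 %/ _) (2 ^ level h0)) hq q1 q2.
rewrite inE -!/(kept_at _ _ _) -eh ek /=.
by rewrite -ew /merge_mid modnMDl modn_mod eh.
Qed.

(* Level [l] is spread over the interval [n / 2 ^ l.+1, n / 2 ^ l[. *)
Definition final_mid (A : edge_set n) h e : nat :=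
  slots h %/ 2 + index e (enum A) %% (slots h - slots h %/ 2).

Lemma final_width h : 0 < slots h - slots h %/ 2.
Proof. by have := slots_gt0 h; move: (slots h) => a; lia. Qed.

Lemma final_mid_bounds A h e : slots h %/ 2 <= final_mid A h e < slots h.
Proof.
have := ltn_pmod (index e (enum A)) (final_width h); rewrite /final_mid.
by have := slots_gt0 h; set l := index e _ %% _; move: l (slots h) => l a; lia.
Qed.

Lemma final_mid_lt A h e : final_mid A h e < n.
Proof.
have /andP[_] := final_mid_bounds A h e; move/leq_trans; apply; exact: leq_div.
Qed.

Lemma card_kept_final G h : #|kept_at G 8 h| <= 64 * (slots h - slots h %/ 2).
Proof.
by apply: leq_trans (card_kept G h (leqnn 8)) _; move: (slots h) => a; lia.
Qed.

Lemma final_mid_src G h w :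
  #|[set e in kept_at G 8 h | insubd p0 (final_mid (kept_at G 8 h) h e) == w]| <= 64.
Proof.
apply: leq_trans (card_residue (w - slots h %/ 2) (card_kept_final G h)).
apply/subset_leq_card/subsetP=> e; rewrite !inE -!/(kept_at _ _ _) => /andP[-> /eqP <-] /=.
by rewrite val_insubd final_mid_lt /final_mid addKn.
Qed.

(** The intervals of different levels are disjoint, so [w] determines the level. At that level at
    most 256 values of [hold 8] remain, and each of these holders sends at most 64 edges through
    [w]. *)
Lemma final_mid_dst G w :
  #|\bigcup_h [set e in kept_at G 8 h | insubd p0 (final_mid (kept_at G 8 h) h e) == w]| <= 256 * 64.
Proof.
set S := \bigcup_h _.
have hlt (e : 'I_n * 'I_n) : hold 8 (erank G e) < n \/ e \notin S.
  have [/bigcupP[h _]|] := boolP (e \in S); last by right.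
  by rewrite inE => /andP[ek _]; left; rewrite (kept_hold ek).
pose hd e : 'I_n := insubd p0 (hold 8 (erank G e)).
have SP e : e \in S -> [/\ e \in kept_at G 8 (hd e), final_mid (kept_at G 8 (hd e)) (hd e) e = w
    & hold 8 (hd e) = hd e].
  case/bigcupP=> h _; rewrite inE => /andP[ek /eqP <-].
  have -> : hd e = h by apply: val_inj; rewrite val_insubd (kept_hold ek) ltn_ord.
  split=> //; first by rewrite val_insubd final_mid_lt.
  rewrite -(kept_hold ek) {1}/hold level_hold //.
  by rewrite /hold mulnK ?expn_gt0.
pose ix e := index e (enum (kept_at G 8 (hd e))).
pose wd e := slots (hd e) - slots (hd e) %/ 2.
have lvl e f : e \in S -> f \in S -> level (hd e) = level (hd f).
  have le a b : a \in S -> b \in S -> level (hd b) <= level (hd a).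
    move=> /SP[_ aw _] /SP[_ bw _]; rewrite leqNgt; apply/negP=> lab.
    have /andP[wa _] := final_mid_bounds (kept_at G 8 (hd a)) (hd a) a.
    have /andP[_ wb] := final_mid_bounds (kept_at G 8 (hd b)) (hd b) b.
    rewrite aw in wa; rewrite bw in wb; move: (leq_ltn_trans wa wb); apply/negP; rewrite -leqNgt.
    by rewrite /slots -divnMA -expnSr; apply: leq_div2l; rewrite ?expn_gt0 ?leq_exp2l.
  by move=> eS fS; apply/eqP; rewrite eqn_leq !le.
(* Edges through [w] are numbered by the leading base-256 digit of their holder and by the pass of
   the cyclic dealing in which they reach [w]. *)
apply: (card_le_inj (f := fun e => hd e %/ 2 ^ (level (hd e) * 8) * 64 + ix e %/ wd e)).
  move=> e f eS fS; have [ek ew eh] := SP e eS; have [fk fw fh] := SP f fS.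
  have small g : g \in S -> ix g %/ wd g < 64.
    move=> gS; have [gk _ _] := SP g gS; rewrite ltn_divLR ?final_width //.
    by apply: leq_trans (card_kept_final G (hd g)); rewrite cardE index_mem mem_enum.
  move=> /(radix_inj (small e eS) (small f fS))[k1 i1].
  have hh : hd e = hd f.
    by apply: val_inj; rewrite /= -eh -fh /hold k1 (lvl e f eS fS).
  have wef : wd f = wd e by rewrite /wd hh.
  have ew' : slots (hd e) %/ 2 + ix e %% wd e = w := ew.
  have fw' : slots (hd f) %/ 2 + ix f %% wd f = w := fw.
  rewrite -hh wef in fw'; rewrite wef in i1.
  have ief : ix e = ix f by apply: (divmod_inj i1); apply: (addnI (etrans ew' (esym fw'))).
  have kef : kept_at G 8 (hd f) = kept_at G 8 (hd e) by rewrite hh.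
  rewrite kef in fk; apply: (index_enum_inj ek fk).
  by move: ief; rewrite /ix kef.
move=> e eS; have [ek ew eh] := SP e eS.
have : ix e %/ wd e < 64.
  rewrite ltn_divLR ?final_width //.
  by apply: leq_trans (card_kept_final G (hd e)); rewrite cardE index_mem mem_enum.
have : hd e %/ 2 ^ (level (hd e) * 8) < 256.
  have -> : 2 ^ (level (hd e) * 8) = 256 ^ level (hd e) by rewrite mulnC expnM.
  by rewrite ltn_divLR ?expn_gt0 // -expnS; apply: level_lt.
by set a := hd e %/ _; set b := ix e %/ _; move: a b => a b; lia.
Qed.

End Filter.

(** * The rounds of the algorithm *)

Lemma single_inj (I : finType) (b b' : bool) (x x' : I) :
    (if b then [set x] else set0) = (if b' then [set x'] else set0) ->
  b = b' /\ (b -> x = x').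
Proof.
case: b b' => [] [] // e; first by split=> // _; apply/set1P; rewrite -e set11.
- by have := set11 x; rewrite e inE.
- by have := set11 x'; rewrite -e inE.
Qed.

(** At most one item per pair of players. Silence is informative too: the receiver learns [b]
    itself. *)
Lemma computable_tell c n K T E (I : finType) (k : nat)
    (b : wgraph n -> 'I_n -> 'I_n -> bool) (x : wgraph n -> 'I_n -> 'I_n -> I) :
    k.+1 <= K -> (2 <= n -> #|I| <= n ^ k) ->
    (forall u G G', poly_weights c G -> poly_weights c G' -> E u G G' ->
       forall v, b G u v = b G' u v /\ (b G u v -> x G u v = x G' u v)) ->
    (forall G, \sum_u \sum_v b G u v <= K * #|edges G|) ->
  computable c K T E ->
  computable c K T.+1 (fun u G G' => E u G G' /\
    forall w, b G w u = b G' w u /\ (b G w u -> x G w u = x G' w u)).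
Proof.
move=> kK In loc cost cE.
have card1 G u v : #|if b G u v then [set x G u v] else set0| = b G u v.
  by case: ifP; rewrite ?cards1 ?cards0.
have := @computable_step c n K T E I 1 k (fun G u v => if b G u v then [set x G u v] else set0).
rewrite mul1n => /(_ kK In) step.
apply: (computable_weaken _ (step _ _ _ cE)).
- by move=> u G G' pG pG' [EG eM]; split=> // w; apply: single_inj.
- move=> u G G' pG pG' EG; apply/funext => v; have [-> ex] := loc u G G' pG pG' EG v.
  by case: ifP ex => // _ ->.
- by move=> u v G _; rewrite card1 leq_b1.
- move=> G _; apply: leq_trans (cost G); apply: leq_sum => u _; apply: leq_sum => v _.
  by rewrite card1.
Qed.

Lemma eq_imset_pred (T U : finType) (f : T -> U) (A B : {pred T}) : A =i B ->
  [set f x | x in A] = [set f x | x in B].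
Proof.
by move=> AB; apply/setP=> y; apply/imsetP/imsetP => -[x xA ->]; exists x; rewrite // ?AB // -AB.
Qed.

Section Algorithm.

Variables (c n : nat) (H : 'I_n -> nat -> {set 'I_n}) (n0 : 0 < n).
Hypothesis H_hitting : forall i, 0 < i -> 256 ^ i < n ->
  (forall v, #|[set s | v \in H s i]| * 4 ^ i <= 8 * n) /\
  (forall L : {set 'I_n}, #|L| = 256 ^ i ->
     #|[set s | [disjoint L & H s i]]| * 4 ^ i <= 8 * n).

Implicit Types (G : wgraph n) (e : 'I_n * 'I_n) (u v w s : 'I_n).
Notation poly G := (poly_weights c G).

Let p0 : 'I_n := Ordinal n0.

Definition best G : 'I_n := [arg min_(s < p0) (base H s + csum H G s)].

Lemma best_good G : base H (best G) + csum H G (best G) <= 16 * n.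
Proof.
have [s le] := exists_good_seed H_hitting G n0.
by rewrite /best; case: arg_minnP => // i _ /(_ s isT) /leq_trans->.
Qed.

Lemma best_ext G G' : (forall s, csum H G s = csum H G' s) -> best G = best G'.
Proof. by move=> eS; rewrite /best; congr (arg_min _ _ _); apply/funext => s; rewrite eS. Qed.

Let ord (k : nat) : 'I_n := insubd p0 k.

Lemma ordK k : k < n -> ord k = k :> nat.
Proof. by move=> kn; rewrite val_insubd kn. Qed.

Let weights := 'I_(2 * n ^ c).+1.
Let number := 'I_(n ^ 3).+1.
Let number_of (k : nat) : number := inord k.

Lemma number_inj j k : j <= n ^ 3 -> k <= n ^ 3 -> number_of j = number_of k -> j = k.
Proof. by move=> jn kn /(congr1 val); rewrite /= !inordK. Qed.

(** The shift by [n ^ c] makes weights nonnegative. A missing edge is coded like weight 0, so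
    decoding presupposes an edge. *)
Definition wcode G v w : weights := inord (absz (odflt 0 (G v w) + (n ^ c)%:Z)%R).

Lemma wcode_inj G G' v w : poly G -> poly G' -> G v w -> G' v w ->
  wcode G v w = wcode G' v w -> G v w = G' v w.
Proof.
move=> /(_ v w) pG /(_ v w) pG'; rewrite /wcode.
case: (G v w) pG => //= a /(_ _ erefl) pa; case: (G' v w) pG' => //= b /(_ _ erefl) pb _ _.
move/(congr1 val); rewrite /= !inordK; move: (n ^ c) pa pb => N pa pb; try lia.
by move=> ab; congr Some; lia.
Qed.

(** * Numbering the half-edges and grouping the vertices into bins *)

Definition deg G v := #|nbrs (G v)|.
Definition pref G v := \sum_(x < n | x < v) deg G x.
Definition tot G := \sum_v deg G v.
Definition big G := n <= tot G.

Lemma pref_step G v v' : v < v' -> pref G v + deg G v <= pref G v'.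
Proof.
move=> vv'; rewrite /pref [X in _ <= X](bigD1 v) //= addnC leq_add2l.
rewrite big_mkcond [X in _ <= X]big_mkcond; apply: leq_sum => x _.
case: ifP => // xv; rewrite (ltn_trans xv vv') /= ifT //.
by apply: contraTneq xv => ->; rewrite ltnn.
Qed.

Lemma pref_tot G v : pref G v + deg G v <= tot G.
Proof.
rewrite /pref /tot [X in _ <= X](bigD1 v) //= addnC leq_add2l.
rewrite big_mkcond [X in _ <= X]big_mkcond; apply: leq_sum => x _.
by case: ifP => // xv; rewrite ifT //; apply: contraTneq xv => ->; rewrite ltnn.
Qed.

Lemma deg_lt G v : deg G v < n.
Proof. exact: nbrs_lt. Qed.

Lemma tot_lt G : tot G <= n ^ 3.
Proof.
apply: leq_trans (leq_sum _ (fun v _ => ltnW (deg_lt G v))) _.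
by rewrite sum_nat_const card_ord (expnS n 2) leq_mul2l -mulnn leq_pmull ?orbT.
Qed.

Lemma totE G : tot G = \sum_v \sum_w (w \in nbrs (G v)).
Proof.
apply: eq_bigr => v _; rewrite /deg -sum1_card big_mkcond.
by apply: eq_bigr => w _; case: (w \in _).
Qed.

Lemma tot_le G : tot G <= 2 * #|edges G|.
Proof.
have -> : tot G = #|[set e : 'I_n * 'I_n | e.2 \in nbrs (G e.1)]|.
  rewrite totE pair_big /= -sum1dep_card [RHS]big_mkcond.
  by apply: eq_bigr => e _; case: (_ \in _).
rewrite mul2n -addnn.
have sub : [set e : 'I_n * 'I_n | e.2 \in nbrs (G e.1)] \subset
    edges G :|: [set (e.2, e.1) | e in edges G].
  apply/subsetP=> -[v w]; rewrite inE /= => vw; have := norm_edge vw.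
  rewrite in_setU /norm; case: ltnP => [_ ->//|_ wv]; apply/orP; right.
  by apply/imsetP; exists (w, v).
apply: leq_trans (subset_leq_card sub) (leq_trans (leq_card_setU _ _) _).
by rewrite leq_add2l leq_imset_card.
Qed.

(** The half-edges at [v] are numbered from [pref G v] on. Vertices of one bin start in the same
    window of length [n] and have degree below [n], so a bin receives fewer than [2 * n]
    half-edges. *)
Definition bin G v := ord (pref G v %/ n).

Lemma tot_n2 G : tot G < n ^ 2.
Proof.
have : \sum_v deg G v <= \sum_(v < n) n.-1.
  by apply: leq_sum => v _; rewrite -ltnS prednK // deg_lt.
rewrite -/(tot G) sum_nat_const card_ord => /leq_ltn_trans; apply.
by rewrite -mulnn ltn_pmul2l // prednK.
Qed.

Lemma bin_val G v : 0 < deg G v -> bin G v = pref G v %/ n :> nat.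
Proof.
move=> d0; rewrite ordK // ltn_divLR // mulnn; apply: leq_ltn_trans (tot_n2 G).
exact: leq_trans (leq_addr _ _) (pref_tot G v).
Qed.

Definition bin_row G a v w := if bin G v == a then G v w else None.

Definition part_cost G s a := \sum_v cost H s (bin_row G a v) v.

Lemma cost_empty s v row : (forall w, row w = None) -> cost H s row v = 0.
Proof.
move=> r0; apply: big1 => i _; rewrite /unhit [#|_|](_ : _ = 0) ?muln0 //.
by apply: eq_card0 => w; rewrite !inE r0.
Qed.

Lemma sum_part_cost G s : \sum_a part_cost G s a = csum H G s.
Proof.
rewrite exchange_big; apply: eq_bigr => v _ /=; rewrite (bigD1 (bin G v)) //=.
rewrite [X in _ + X]big1 => [|a ab].
  rewrite addn0; congr cost; apply/funext => w.
  by rewrite /bin_row eqxx.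
by apply: cost_empty => w; rewrite /bin_row eq_sym (negPf ab).
Qed.

(** Bins past the last half-edge are empty; their players may stay silent when costs are
    reported. *)
Lemma part_cost0 G s (a : 'I_n) : tot G < a * n -> part_cost G s a = 0.
Proof.
move=> ta; apply: big1 => v _; apply: cost_empty => w; rewrite /bin_row.
case: eqP => // bv; case Gvw: (G v w) => [z|//].
have d0 : 0 < deg G v by apply/card_gt0P; exists w; rewrite inE Gvw.
have := pref_tot G v; move: (bin_val d0); rewrite bv => av.
have := leq_trunc_div (pref G v) n; rewrite -av; lia.
Qed.

Lemma csum_le G s : csum H G s <= n ^ 3.
Proof.
have le v : cost H s (G v) v <= n ^ 2.
  apply: (@leq_trans (\sum_(i < n) n)); last by rewrite sum_nat_const card_ord mulnn.
  rewrite /cost big_mkcond; apply: leq_sum => i _; case: ifP => // _.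
  rewrite /unhit; case: ltnP => [lt|_]; last by rewrite muln0.
  case: [disjoint _ & _]; rewrite ?muln0 ?muln1 //.
  apply: leq_trans (ltnW (ltn_trans lt (nbrs_lt G v))).
  by case: (i : nat) => // j; rewrite leq_exp2r.
apply: leq_trans (leq_sum _ (fun v _ => le v)) _.
by rewrite sum_nat_const card_ord expnS.
Qed.

Lemma part_cost_le G s a : part_cost G s a <= n ^ 3.
Proof.
by apply: leq_trans (csum_le G s); rewrite -sum_part_cost (bigD1 a) //= leq_addr.
Qed.

(** * Edges decorated with the data that filtering needs *)

Let clus := seed_cluster H best.
Let alive := alive_at H best.
Let grp := held_at H best.
Let kept := kept_at H best.

(** The ends of an edge, its weight and rank, and the clusters of both ends at the level of the
    edge. *)
Definition item := ('I_n * 'I_n * weights * 'I_n * 'I_n * 'I_n)%type.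

Definition deco G e : item :=
  (e.1, e.2, wcode G e.1 e.2, ord (erank G e),
   clus G (level (erank G e)) e.1, clus G (level (erank G e)) e.2).

Definition item_rank (x : item) : nat := x.1.1.2.

Lemma deco_rank G e : e \in edges G -> item_rank (deco G e) = erank G e.
Proof. by move=> eE; rewrite /item_rank /= ordK // erank_lt. Qed.

Lemma edge_some G e : e \in edges G -> isSome (G e.1 e.2).
Proof. by rewrite inE => /andP[]. Qed.

Lemma deco_inj G G' e e' : poly G -> poly G' -> e \in edges G -> e' \in edges G' ->
    deco G e = deco G' e' ->
  [/\ e = e', key G e = key G' e', erank G e = erank G' e',
      clus G (level (erank G e)) e.1 = clus G' (level (erank G e)) e.1
    & clus G (level (erank G e)) e.2 = clus G' (level (erank G e)) e.2].
Proof.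
move=> pG pG' eE eE' de.
have er : erank G e = erank G' e' by rewrite -(deco_rank eE) de deco_rank.
have ee : e = e' by move: de; case: (e) (e') => a b [a' b'] [-> ->].
subst e'.
have ew : wcode G e.1 e.2 = wcode G' e.1 e.2 := congr1 (fun x : item => x.1.1.1.2) de.
have c1 : clus G (level (erank G e)) e.1 = clus G' (level (erank G' e)) e.1 :=
  congr1 (fun x : item => x.1.2) de.
have c2 : clus G (level (erank G e)) e.2 = clus G' (level (erank G' e)) e.2 :=
  congr1 snd de.
have ek : key G e = key G' e.
  by rewrite /key (wcode_inj pG pG' (edge_some eE) (edge_some eE') ew).
exact: And5 erefl ek er
  (etrans c1 (congr1 (fun r => clus G' (level r) e.1) (esym er)))
  (etrans c2 (congr1 (fun r => clus G' (level r) e.2) (esym er))).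
Qed.

Lemma deco_set_inj G G' (A A' : edge_set n) : poly G -> poly G' ->
    {subset A <= edges G} -> {subset A' <= edges G'} ->
    [set deco G e | e in A] = [set deco G' e | e in A'] ->
  A = A' /\ {in A, deco G =1 deco G'}.
Proof.
move=> pG pG' AE AE' eA.
have h1 e : e \in A -> e \in A' /\ deco G e = deco G' e.
  move=> eA1; have : deco G e \in [set deco G' e | e in A'] by rewrite -eA imset_f.
  case/imsetP=> e' eA' de; have [ee _ _ _ _] := deco_inj pG pG' (AE _ eA1) (AE' _ eA') de.
  by rewrite ee in de *.
have h2 e : e \in A' -> e \in A.
  move=> eA1; have : deco G' e \in [set deco G e | e in A] by rewrite eA imset_f.
  by case/imsetP=> e' eA' /(deco_inj pG' pG (AE' _ eA1) (AE _ eA'))[->].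
by split=> [|e /h1[]//]; apply/setP=> e; apply/idP/idP => [/h1[]|/h2].
Qed.

Lemma survivors_ext (key1 key2 : 'I_n * 'I_n -> int) (cl1 cl2 : 'I_n -> 'I_n) (A : edge_set n) :
    {in A, key1 =1 key2} -> (forall e, e \in A -> cl1 e.1 = cl2 e.1 /\ cl1 e.2 = cl2 e.2) ->
  survivors key1 cl1 A = survivors key2 cl2 A.
Proof.
move=> ek ec; apply/setP=> e; rewrite [LHS]inE [RHS]inE; case eA: (e \in A) => //=.
have [-> ->] := ec e eA; congr (~~ conn _ _ _).
have -> : lighter key1 A e = lighter key2 A e.
  by apply/setP=> f; rewrite !inE; case fA: (f \in A); rewrite //= !ek.
apply: eq_in_imset => f; rewrite inE => /andP[fA _].
by have [-> ->] := ec f fA.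
Qed.

(** Filtering consults only keys and clusters recorded in the items, so a holder can do it although
    clusters depend on rows it has never seen. *)
Lemma kept_ext G G' j (h : 'I_n) : j <= 8 -> poly G -> poly G' ->
    [set deco G e | e in grp G j h] = [set deco G' e | e in grp G' j h] ->
  kept G j h = kept G' j h /\ {in kept G j h, deco G =1 deco G'}.
Proof.
move=> j8 pG pG'; have gE G1 : {subset grp G1 j h <= edges G1} by move=> e; apply: grp_edge.
case/(deco_set_inj pG pG' (gE G) (gE G')) => eg ed; split; last first.
  by move=> e /kept_grp/ed.
rewrite /kept /kept_at -/grp -eg; apply: survivors_ext => e eG.
  have eG' : e \in edges G' by apply: gE; rewrite -eg.
  by have [] := deco_inj pG pG' (gE _ _ eG) eG' (ed e eG).
have eG' : e \in edges G' by apply: gE; rewrite -eg.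
have [_ _ _ c1 c2] := deco_inj pG pG' (gE _ _ eG) eG' (ed e eG).
have <- : level (erank G e) = level h.
  by move: eG; rewrite inE => /andP[_ /eqP <-]; rewrite level_hold.
by split; [exact: c1|exact: c2].
Qed.

Variables cap K : nat.
Hypothesis cap_ge : 256 * 64 <= cap.
Hypothesis K_ge : cap * (c + 8).+1 <= K.

Lemma cap64 : 64 <= cap.
Proof. by apply: leq_trans cap_ge; rewrite leq_pmull. Qed.

Lemma kk_K : (c + 8).+1 <= K.
Proof. by apply: leq_trans K_ge; rewrite leq_pmull // (leq_trans _ cap64). Qed.

Lemma cost_bound G x : x <= 2 * tot G -> x <= K * #|edges G|.
Proof.
move=> xt; apply: leq_trans xt _; apply: (@leq_trans (4 * #|edges G|)).
  by have := tot_le G; lia.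
by rewrite leq_mul2r; apply/orP; right; apply: leq_trans kk_K; lia.
Qed.

(** The exponent [c + 8] fits every type of item: a pair of numbers up to [n ^ 3] needs 8, a
    decorated edge [c + 7]. *)
Lemma pow_le a : 2 <= n -> a <= c + 8 -> n ^ a <= n ^ (c + 8).
Proof. by move=> n2 ac; rewrite leq_pexp2l. Qed.

Lemma card_player : 2 <= n -> #|{: 'I_n}| <= n ^ (c + 8).
Proof. by move=> n2; rewrite card_ord -[X in X <= _]expn1 pow_le //; lia. Qed.

Lemma number_le : 2 <= n -> (n ^ 3).+1 <= n ^ 4.
Proof.
move=> n2; rewrite (expnS n 3); apply: (@leq_trans (2 * n ^ 3)); last by rewrite leq_mul2r n2 orbT.
by rewrite mul2n -addnn -add1n leq_add2r expn_gt0 n0.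
Qed.

Lemma card_number : 2 <= n -> #|{: number}| <= n ^ (c + 8).
Proof. by move=> n2; rewrite card_ord; apply: leq_trans (number_le n2) _; rewrite pow_le //; lia. Qed.

Lemma card_number2 : 2 <= n -> #|{: number * number}| <= n ^ (c + 8).
Proof.
move=> n2; rewrite card_prod card_ord; apply: leq_trans (leq_mul (number_le n2) (number_le n2)) _.
by rewrite -expnD pow_le //; lia.
Qed.

Lemma card_weights : 2 <= n -> (2 * n ^ c).+1 <= n ^ (c + 2).
Proof.
move=> n2; rewrite expnD; have : 4 <= n ^ 2 by rewrite -mulnn (leq_mul n2 n2).
have : 0 < n ^ c by rewrite expn_gt0 n0.
move: (n ^ c) (n ^ 2) => a b; nia.
Qed.

Definition route_item := ('I_n * 'I_n * weights * 'I_n)%type.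

Lemma card_route_item : 2 <= n -> #|{: route_item}| <= n ^ (c + 8).
Proof.
move=> n2; rewrite !card_prod !card_ord.
apply: (@leq_trans (n * n * n ^ (c + 2) * n)); first by rewrite !leq_mul // card_weights.
by rewrite mulnn -expnD -expnSr pow_le //; lia.
Qed.

Lemma card_item : 2 <= n -> #|{: item}| <= n ^ (c + 8).
Proof.
move=> n2; rewrite !card_prod !card_ord.
apply: (@leq_trans (n * n * n ^ (c + 2) * n * n * n)); first by rewrite !leq_mul // card_weights.
by rewrite mulnn -expnD -!expnSr pow_le //; lia.
Qed.

(** * What is known after each round *)

Definition view_ranks u G G' := wt G u = wt G' u /\
  forall w, w \in nbrs (G u) -> rank (G w) w u = rank (G' w) w u.

Lemma know_ranks : computable c K 1 view_ranks.
Proof.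
have := @computable_tell c n K 0 _ 'I_n (c + 8) (fun G u v => v \in nbrs (G u))
  (fun G u v => ord (rank (G u) u v)) kk_K card_player.
move=> /(_ _ _ _ (@computable_row c n K)) step; apply: computable_weaken (step _ _).
- move=> u G G' _ _ [row msg]; split=> // w wu; have [e1 e2] := msg w.
  have uw : u \in nbrs (G w) by rewrite nbrs_sym.
  have := congr1 val (e2 uw); rewrite /= !ordK ?rank_ltn //.
  by rewrite -e1.
- by move=> u G G' _ _ row v; rewrite row.
- by move=> G; apply: cost_bound; rewrite -totE leq_pmull.
Qed.

Definition view_degs u G G' := view_ranks u G G' /\
  (u = p0 -> forall v, deg G v = deg G' v).

Lemma sum_player0 (b : bool) : \sum_(v < n) ((v == p0) && b : nat) = b.
Proof.
by rewrite (bigD1 p0) //= ?eqxx big1 ?addn0 // => v /negPf->.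
Qed.

(** Isolated vertices stay silent, which [p0] reads as degree 0; so the round costs at most [tot G]
    messages. *)
Lemma know_degs : computable c K 2 view_degs.
Proof.
have := @computable_tell c n K 1 _ 'I_n (c + 8) (fun G u v => (v == p0) && (0 < deg G u))
  (fun G u v => ord (deg G u)) kk_K card_player.
move=> /(_ _ _ _ know_ranks) step; apply: computable_weaken (step _ _).
- move=> u G G' _ _ [vr msg]; split=> // up v; have [e1 e2] := msg v.
  move: e1 e2; rewrite up eqxx /=; case: posnP => [-> + _|d0 d1 /(_ isT)/(congr1 val)].
    by move/esym/negbT; rewrite -eqn0Ngt => /eqP.
  by rewrite /= !ordK ?deg_lt.
- by move=> u G G' _ _ [row _] v; rewrite /deg row.
- move=> G; apply: cost_bound; apply: (@leq_trans (tot G)); last by rewrite leq_pmull.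
  by apply: leq_sum => u _; rewrite sum_player0; case: (deg G u).
Qed.

Definition view_prefix u G G' :=
  [/\ view_ranks u G G', big G = big G', big G -> tot G = tot G'
    & 0 < deg G u -> pref G u = pref G' u].

(** Without [n] half-edges [p0] can afford to answer the non-isolated vertices only. An isolated
    vertex learns [big G] from whether an answer arrives at all. *)
Lemma know_prefix : computable c K 3 view_prefix.
Proof.
have := @computable_tell c n K 2 _ (number * number)%type (c + 8)
  (fun G u v => (u == p0) && ((0 < deg G v) || big G))
  (fun G u v => (number_of (pref G v), number_of (tot G))) kk_K card_number2.
move=> /(_ _ _ _ know_degs) step; apply: computable_weaken (step _ _).
- move=> u G G' _ _ [[[row rk] _] msg].
  have eqd : deg G u = deg G' u by rewrite /deg row.
  have [/= e1 e2] := msg p0.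
  have pn G1 : pref G1 u <= n ^ 3 by apply: leq_trans (leq_trans (leq_addr _ _) (pref_tot G1 u)) (tot_lt G1).
  have e3 : (0 < deg G u) || big G -> pref G u = pref G' u /\ tot G = tot G'.
    move=> h; have [] := e2 h; rewrite /= => h1 h2.
    by split; [apply: number_inj h1|apply: number_inj h2]; rewrite ?tot_lt ?pn.
  split=> //.
  + have [d0|d0] := posnP (deg G u).
      by move: e1; rewrite -eqd d0.
    by have [|_ et] := e3 _; rewrite ?d0 // /big et.
  + by move=> h; have [|] := e3 _; rewrite ?h ?orbT.
  + by move=> h; have [|] := e3 _; rewrite ?h.
- move=> u G G' _ _ [[row rk] dg] v; case: eqP => //= /dg eqd.
  have et : tot G = tot G' by apply: eq_bigr => w _; apply: eqd.
  have ep : pref G v = pref G' v by apply: eq_bigr => w _; apply: eqd.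
  by rewrite /big et ep eqd.
- move=> G; apply: cost_bound; rewrite exchange_big /=.
  apply: (@leq_trans (\sum_v (deg G v + big G))); last first.
    rewrite big_split /= sum_nat_const card_ord mul2n -addnn leq_add2l /big.
    by case: (leqP n (tot G)) => nt; rewrite ?muln1 ?muln0.
  by apply: leq_sum => v _; rewrite sum_player0; case: (deg G v) => [|d]; case: (big G).
Qed.

Definition slot G e := pref G e.1 + rank (G e.1) e.1 e.2.

Lemma slot_inj G e f : e.2 \in nbrs (G e.1) -> f.2 \in nbrs (G f.1) ->
  slot G e = slot G f -> e = f.
Proof.
case: e f => v w [v' w'] /= vw vw'; rewrite /slot /=.
have h1 := rank_lt vw; have h2 := rank_lt vw'; rewrite -/(deg G v) in h1; rewrite -/(deg G v') in h2.
case: (ltngtP v v') => [/(pref_step G) p e|/(pref_step G) p e|/val_inj evv]; [lia|lia|].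
by move: vw'; rewrite -evv => vw' /addnI/(rank_inj vw vw')->.
Qed.

Definition view_bins u G G' :=
  [/\ view_ranks u G G', big G = big G', big G -> tot G = tot G'
    & forall v, bin_row G u v = bin_row G' u v].

(** Half-edges travel through the player given by their number modulo [n]. Those of one vertex are
    fewer than [n] consecutive numbers, so they use distinct intermediates; those of one bin lie in
    a window of length [2 * n], so each intermediate forwards at most two to it. *)
Lemma know_bins : computable c K 5 view_bins.
Proof.
pose A G v := [set e : 'I_n * 'I_n | (e.1 == v) && (e.2 \in nbrs (G e.1))].
pose dec G e : route_item := (e.1, e.2, wcode G e.1 e.2, bin G e.1).
pose mid G (v : 'I_n) e := ord (slot G e %% n).
pose dst (x : route_item) := x.2.
have AP G v e : e \in A G v -> e.1 = v /\ e.2 \in nbrs (G e.1).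
  by rewrite inE => /andP[/eqP].
have deg0 G v e : e \in A G v -> 0 < deg G v.
  by move=> /AP[<- ev]; apply/card_gt0P; exists e.2.
have midE G v e : mid G v e = slot G e %% n :> nat by rewrite ordK // ltn_mod.
have := @computable_route c n K 3 _ _ route_item cap (c + 8) A dec mid dst K_ge card_route_item.
move=> /(_ _ _ _ _ _ know_prefix) step; apply: computable_weaken (step _ _ _ _).
- move=> u G G' pG pG' [[vr eb et _] es]; split=> // v; apply/funext => w.
  have sub G1 G2 z : poly G1 -> poly G2 ->
      [set dec G1 e | e in \bigcup_v A G1 v & dst (dec G1 e) == u]
        = [set dec G2 e | e in \bigcup_v A G2 v & dst (dec G2 e) == u] ->
      bin_row G1 u v w = Some z -> bin_row G2 u v w = Some z.
    move=> p1 p2 e12; rewrite {1}/bin_row; case: eqP => // bv Gvw.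
    have : dec G1 (v, w) \in [set dec G1 e | e in \bigcup_v A G1 v & dst (dec G1 e) == u].
      apply/imsetP; exists (v, w) => //; rewrite inE /dst /= bv eqxx andbT.
      by apply/bigcupP; exists v; rewrite // !inE eqxx /= Gvw.
    rewrite e12 => /imsetP[[v' w']]; rewrite inE => /andP[/bigcupP[x _ /AP[/= _ vw']] bv'].
    rewrite /dec /= => -[ev ew ec ebin]; subst v' w'.
    rewrite /bin_row -ebin bv eqxx -Gvw; apply/esym/(wcode_inj p1 p2) => //; first by rewrite Gvw.
    by move: vw'; rewrite inE.
  case e1: (bin_row G u v w) => [z|]; first by rewrite (sub G G' z).
  by case e2: (bin_row G' u v w) => [z|//]; rewrite -e1 (sub G' G z).
- move=> u G G' pG pG' [[row rk] eb et ep]; split.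
  + apply/setP=> e; rewrite !inE; case: eqP => //= ->; by rewrite row.
  + move=> e /[dup] /deg0/ep p /AP[eu _]; rewrite /dec /wcode /bin eu p.
    by rewrite row.
  + by move=> e /[dup] /deg0/ep p /AP[eu _]; rewrite /mid /slot eu p row.
- move=> u w G pG; apply: (@leq_trans 1); last by apply: leq_trans cap64.
  apply: (card_le_inj (f := fun=> 0)) => // e f; rewrite inE => /andP[/AP[eu en] /eqP em].
  rewrite inE => /andP[/AP[fu fn] /eqP fm] _.
  have := congr1 val em; have := congr1 val fm; rewrite /= !midE => <- /eqP.
  rewrite eu in en; rewrite fu in fn.
  rewrite /slot eu fu eqn_modDl !modn_small ?rank_ltn // => /eqP/(rank_inj en fn) e2.
  by rewrite (surjective_pairing e) (surjective_pairing f) eu fu e2.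
- move=> w a G pG; apply: (@leq_trans 2); last by apply: leq_trans cap64.
  have SP e : e \in \bigcup_u [set e in A G u | (mid G u e == w) && (dst (dec G e) == a)] ->
      [/\ e.2 \in nbrs (G e.1), slot G e %% n = w & a <= slot G e %/ n < a.+2].
    case/bigcupP=> u _; rewrite inE => /and3P[eA /eqP em /eqP ea].
    have [eu en] := AP _ _ _ eA; split=> //; first by rewrite -em midE.
    have d0 := deg0 _ _ _ eA; rewrite -eu in d0.
    rewrite -ea /dst /= bin_val //; have := rank_ltn en; rewrite /slot => rn.
    rewrite leq_div2r ?leq_addr //= ltn_divLR // !mulSn addnA.
    have := ltn_ceil (pref G e.1) n0; rewrite mulSn => h; lia.
  apply: (card_le_inj (f := fun e => slot G e %/ n - a)).
    move=> e f /SP[en em /andP[e1 e2]] /SP[fn fm /andP[f1 f2]] ef.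
    apply: (slot_inj en fn); apply: (@divmod_inj n); last by rewrite em fm.
    lia.
  by move=> e /SP[_ _ /andP[e1 e2]]; lia.
- move=> G pG; apply: cost_bound; apply: (@leq_trans (tot G)); last by rewrite leq_pmull.
  apply: leq_sum => v _; apply: leq_trans (leq_imset_card (pair v) _).
  apply/subset_leq_card/subsetP=> -[x y] /AP[/= -> xy]; apply/imsetP; exists y => //.
Qed.

Definition small_known u G G' := u = p0 -> ~~ big G -> forall v, wt G v = wt G' v.

(** With fewer than [n] half-edges every prefix sum is below [n], and bin 0, which is [p0], receives
    all edges. *)
Lemma bins_small u G G' : view_bins u G G' -> small_known u G G'.
Proof.
case=> _ eb _ er up nb v; apply/funext => w.
have full G1 : ~~ big G1 -> bin_row G1 p0 v w = G1 v w.
  move=> nb1; have t : tot G1 < n by rewrite ltnNge.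
  rewrite /bin_row; case: eqP => // bv.
  case Gvw: (G1 v w) => [z|//]; case: bv; apply: val_inj => /=.
  have d0 : 0 < deg G1 v by apply/card_gt0P; exists w; rewrite inE Gvw.
  rewrite bin_val // divn_small //; apply: leq_ltn_trans t.
  exact: leq_trans (leq_addr _ _) (pref_tot G1 v).
rewrite -full // -(full G') -?eb //; have := er v; rewrite up; by move/(congr1 (@^~ w)).
Qed.

Definition view_costs u G G' :=
  [/\ view_ranks u G G', big G = big G', small_known u G G'
    & big G -> csum H G u = csum H G' u].

(** Each nonempty bin reports to player [s] its share of the cost of seed [s]. There are at most
    [tot G / n + 1] reporting bins with [n] reports each, which is [O(tot G)] as [n <= tot G]. *)
Lemma know_costs : computable c K 6 view_costs.
Proof.
have := @computable_tell c n K 5 _ number (c + 8)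
  (fun G (u v : 'I_n) => big G && (u * n <= tot G))
  (fun G u v => number_of (part_cost G v u)) kk_K card_number.
move=> /(_ _ _ _ know_bins) step; apply: computable_weaken (step _ _).
- move=> u G G' _ _ [vb msg]; have sk := bins_small vb; case: vb => vr eb et _; apply: (And4 vr eb sk) => bG.
  rewrite -!sum_part_cost; apply: eq_bigr => a _; have [_ e2] := msg a.
  have [ta|ta] := leqP (a * n) (tot G); last by rewrite !part_cost0 // -et.
  by apply: number_inj (e2 _); rewrite ?part_cost_le // bG ta.
- move=> u G G' _ _ [_ eb et er] v; split.
    by rewrite -eb; case: (boolP (big G)) => // /et->.
  by move=> _; congr number_of; apply: eq_bigr => x _; rewrite er.
- move=> G; apply: cost_bound; have [bG|_] := boolP (big G); last by rewrite big1 // => u _; rewrite big1.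
  under eq_bigr do rewrite sum_nat_const card_ord.
  rewrite -big_distrr /=.
  have -> : \sum_(u < n) (u * n <= tot G : nat) = #|[set u : 'I_n | u * n <= tot G]|.
    by rewrite -sum1dep_card [RHS]big_mkcond; apply: eq_bigr => u _; case: leqP.
  apply: (@leq_trans (n * (tot G %/ n).+1)).
    rewrite leq_mul2l; apply/orP; right; apply: (card_le_inj (f := val)) => [x y _ _|x].
      exact: val_inj.
    by rewrite inE ltnS leq_divRL.
  have := leq_trunc_div (tot G) n; have : n <= tot G := bG; rewrite mulnS mulnC; lia.
Qed.

Definition view_sums u G G' :=
  [/\ view_ranks u G G', big G = big G', small_known u G G'
    & u = p0 -> big G -> best G = best G'].

Lemma know_sums : computable c K 7 view_sums.
Proof.
have := @computable_tell c n K 6 _ number (c + 8)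
  (fun G (u v : 'I_n) => (v == p0) && big G)
  (fun G u v => number_of (csum H G u)) kk_K card_number.
move=> /(_ _ _ _ know_costs) step; apply: computable_weaken (step _ _).
- move=> u G G' _ _ [[vr eb sk _] msg]; apply: (And4 vr eb sk) => up bG.
  apply: best_ext => s; have [_ e2] := msg s; apply: number_inj (e2 _); rewrite ?csum_le //.
  by rewrite up eqxx bG.
- move=> u G G' _ _ [_ -> _ es] v; split=> [//|/andP[_ bG]]; congr number_of.
  by apply: es.
- move=> G; apply: cost_bound; under eq_bigr do rewrite sum_player0.
  rewrite sum_nat_const card_ord; have [bG|_] := boolP (big G); rewrite ?muln0 //.
  by rewrite muln1 (leq_trans bG) // leq_pmull.
Qed.

Definition view_best u G G' :=
  [/\ view_ranks u G G', big G = big G', small_known u G G'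
    & big G -> best G = best G'].

Lemma know_best : computable c K 8 view_best.
Proof.
have := @computable_tell c n K 7 _ 'I_n (c + 8)
  (fun G (u v : 'I_n) => (u == p0) && big G) (fun G u v => best G) kk_K card_player.
move=> /(_ _ _ _ know_sums) step; apply: computable_weaken (step _ _).
- move=> u G G' _ _ [[vr eb sk _] msg]; apply: (And4 vr eb sk) => bG.
  by have [_] := msg p0; apply; rewrite eqxx.
- move=> u G G' _ _ [_ -> _ es] v; split=> [//|/andP[/eqP up bG]].
  exact: es.
- move=> G; apply: cost_bound; rewrite exchange_big /=; under eq_bigr do rewrite sum_player0.
  rewrite sum_nat_const card_ord; have [bG|_] := boolP (big G); rewrite ?muln0 //.
  by rewrite muln1 (leq_trans bG) // leq_pmull.
Qed.

Definition view_clusters u G G' := view_best u G G' /\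
  (big G -> forall w, w \in nbrs (G u) ->
    clus G (level (edge_rank G u w)) w = clus G' (level (edge_rank G u w)) w).

Lemma view_ranks_edge u w G G' : view_ranks u G G' -> w \in nbrs (G u) ->
  edge_rank G u w = edge_rank G' u w.
Proof. by case=> row rk wu; rewrite /edge_rank (rk w wu) row. Qed.

(** A vertex has a cluster at every level, but a neighbour needs only the one at the level of their
    common edge, so one message suffices. *)
Lemma know_clusters : computable c K 9 view_clusters.
Proof.
have := @computable_tell c n K 8 _ 'I_n (c + 8)
  (fun G u v => big G && (v \in nbrs (G u)))
  (fun G u v => clus G (level (edge_rank G u v)) u) kk_K card_player.
move=> /(_ _ _ _ know_best) step; apply: computable_weaken (step _ _).
- move=> u G G' _ _ [vb msg]; split=> [|bG w wu]; first exact: vb.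
  have [_ e2] := msg w.
  have vr : view_ranks u G G' by case: vb.
  rewrite edge_rankC e2; last by rewrite bG nbrs_sym.
  by rewrite edge_rankC -(view_ranks_edge vr wu) edge_rankC.
- move=> u G G' _ _ [vr eb _ es] v; have [row _] := vr; split; first by rewrite eb row.
  move=> /andP[bG vu]; rewrite (view_ranks_edge vr vu).
  by rewrite /clus /seed_cluster (es bG) row.
- move=> G; apply: cost_bound; apply: (@leq_trans (tot G)); last by rewrite leq_pmull.
  rewrite totE; apply: leq_sum => u _; apply: leq_sum => v _.
  by case: (big G); case: (v \in _).
Qed.

Definition view_items j u G G' :=
  [/\ big G = big G', small_known u G G'
    & big G -> [set deco G e | e in grp G j u] = [set deco G' e | e in grp G' j u]].

Lemma grp0P G e (h : 'I_n) : (e \in grp G 0 h) = (e \in edges G) && (erank G e == h).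
Proof. by rewrite inE hold0. Qed.

(** An edge is sent by the end where its rank is smaller, directly to the player numbered by that
    rank; ranks at one vertex are distinct, so each pair exchanges at most one item. In a tie both
    ends send the same item, and the union absorbs the duplicate. *)
Lemma know_items : computable c K 10 (view_items 0).
Proof.
pose N G u (h : 'I_n) := [set w in nbrs (G u) | (rank (G u) u w == h) && (rank (G u) u w <= rank (G w) w u)].
pose M G u h := if big G then [set deco G (norm u w) | w in N G u h] else set0.
have cN G u h : #|N G u h| <= 1.
  apply: (card_le_inj (f := fun=> 0)) => // v w; rewrite !inE -!nbrsE.
  move=> /andP[vN /andP[/eqP vh _]] /andP[wN /andP[/eqP wh _]] _.
  by apply: (rank_inj vN wN); rewrite vh wh.
have cM G u h : #|M G u h| <= #|N G u h|.
  by rewrite /M; case: ifP => _; rewrite ?leq_imset_card ?cards0.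
have cost G : \sum_u \sum_v #|M G u v| <= K * #|edges G|.
  apply: cost_bound; apply: (@leq_trans (tot G)); last by rewrite leq_pmull.
  apply: leq_sum => u _; apply: leq_trans (leq_sum _ (fun v _ => cM G u v)) _.
  rewrite (sum_card_swap (fun (h w : 'I_n) => (w \in nbrs (G u)) && ((rank (G u) u w == h) && (rank (G u) u w <= rank (G w) w u)))).
  rewrite /deg -sum1_card [X in _ <= X]big_mkcond; apply: leq_sum => w _; case: ifP => wu; last first.
    by rewrite leqn0 cards_eq0; apply/eqP/setP=> h; rewrite !inE.
  apply: (card_le_inj (f := fun=> 0)) => // h h'; rewrite !inE /=.
  by move=> /andP[/eqP eh _] /andP[/eqP eh' _] _; apply: val_inj; rewrite /= -eh eh'.
have := @computable_step c n K 9 _ item cap (c + 8) M K_ge card_item.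
move=> /(_ _ _ _ (fun G _ => cost G) know_clusters) step; apply: computable_weaken (step _ _).
- move=> u G G' pG pG' [[vb _] eM]; have [_ eb sk _] := vb; apply: (And3 eb sk) => bG.
  have setE G1 : big G1 -> [set deco G1 e | e in grp G1 0 u] = \bigcup_w M G1 w u.
    move=> b1; apply/setP=> x; apply/imsetP/bigcupP.
      case=> e; rewrite grp0P => /andP[eE /eqP er] ->.
      have [en e12] := edge_norm eE.
      have [v [w [vw wv er' nvw]]] : exists v w, [/\ w \in nbrs (G1 v),
         rank (G1 v) v w <= rank (G1 w) w v, rank (G1 v) v w = erank G1 e & norm v w = e].
        rewrite /erank /edge_rank; case: (leqP (rank (G1 e.1) e.1 e.2) (rank (G1 e.2) e.2 e.1)) => le.
          by exists e.1, e.2.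
        by exists e.2, e.1; rewrite nbrs_sym normC; split=> //; apply: ltnW.
      exists v => //; rewrite /M b1; apply/imsetP; exists w; last by rewrite nvw.
      by rewrite inE vw er' er eqxx /= -er -er'.
    case=> v _; rewrite /M b1 => /imsetP[w]; rewrite inE => /andP[vw /andP[/eqP rv le]] ->.
    exists (norm v w) => //; rewrite grp0P norm_edge //= erank_norm /edge_rank.
    by rewrite (minn_idPl le) rv.
  rewrite !setE -?eb //; by apply: eq_bigr => w _.
- move=> u G G' pG pG' [[vr eb _ es] ec]; apply/funext => h; rewrite /M -eb.
  case: ifP => // bG; have [row rk] := vr.
  have eN : N G u h = N G' u h.
    by apply/setP=> w; rewrite inE [RHS]inE -row; case wu: (w \in _); rewrite //= rk.
  rewrite -eN; apply: eq_in_imset => w; rewrite inE => /andP[wu _].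
  have er := view_ranks_edge vr wu.
  have cu i : clus G i u = clus G' i u by rewrite /clus /seed_cluster (es bG) row.
  have cw := ec bG w wu; have ew : G u w = G' u w by rewrite row.
  have wc : wcode G u w = wcode G' u w by rewrite /wcode ew.
  have wc' : wcode G w u = wcode G' w u by rewrite /wcode !(wt_sym _ w u) ew.
  rewrite /deco !erank_norm -er; case: (norm_ends u w) => -> /=.
    by rewrite wc cu cw.
  by rewrite wc' cu cw.
- by move=> u v G _; apply: leq_trans (cM G u v) (leq_trans (cN _ _ _) (leq_trans _ cap64)).
Qed.

Lemma kept_cost j G : \sum_h #|if big G then kept G j h else set0| <= K * #|edges G|.
Proof.
apply: (@leq_trans #|edges G|); last by rewrite leq_pmull // (leq_trans _ kk_K).
apply: leq_trans (kept_sum H best G j); apply: leq_sum => h _.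
by case: ifP => // _; rewrite cards0.
Qed.

Lemma know_merge T j : j < 8 ->
  computable c K T (view_items j) -> computable c K T.+2 (view_items j.+1).
Proof.
move=> j8 cj; pose A G h := if big G then kept G j h else set0.
(* Nothing is sent unless [big G]: otherwise no seed was announced, and [p0] knows the graph
   already. *)
pose mid G (h : 'I_n) e : 'I_n := insubd p0 (merge_mid j (kept G j h) h e).
pose dst x : 'I_n := insubd p0 (hold j.+1 (item_rank x)).
have AT G h : big G -> A G h = kept G j h by rewrite /A => ->.
have AF G h : ~~ big G -> A G h = set0 by rewrite /A => /negPf->.
have AE G h e : e \in A G h -> e \in kept G j h by rewrite /A; case: ifP; rewrite ?inE.
have dstE G e : e \in edges G -> dst (deco G e) = insubd p0 (hold j.+1 (erank G e)).
  by move=> eE; rewrite /dst deco_rank.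
have := @computable_route c n K T _ _ item cap (c + 8) A deco mid dst K_ge card_item.
move=> /(_ _ _ _ _ _ cj) step; apply: computable_weaken (step _ _ _ _).
- move=> u G G' pG pG' [[eb sk _] es]; apply: (And3 eb sk) => bG.
  have setE G1 : big G1 -> [set e in \bigcup_v A G1 v | dst (deco G1 e) == u] = grp G1 j.+1 u.
    move=> b1; have -> : \bigcup_v A G1 v = alive G1 j.+1.
      by rewrite /alive aliveS; apply: eq_bigr => v _; rewrite /A b1.
    apply/setP=> e; rewrite inE [RHS]inE; case eA: (e \in alive G1 j.+1) => //=.
    have eE := alive_edge eA; rewrite dstE // -val_eqE val_insubd.
    by rewrite (leq_ltn_trans (hold_le _ _) (erank_lt eE)).
  have b' : big G' by rewrite -eb.
  rewrite -(setE G bG) -(setE G' b').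
  have simp G1 : [set deco G1 e | e in [set e in \bigcup_v A G1 v | dst (deco G1 e) == u]]
     = [set deco G1 e | e in \bigcup_v A G1 v & dst (deco G1 e) == u].
    by apply: eq_imset_pred => e; rewrite !inE.
  exact: etrans (simp G) (etrans es (esym (simp G'))).
- move=> u G G' pG pG' [eb _ es]; have [bG|nb] := boolP (big G); last first.
    have nb' : ~~ big G' by rewrite -eb.
    apply: And3; first exact: etrans (AF G u nb) (esym (AF G' u nb')).
      by move=> e eA; exfalso; move: eA; rewrite (AF G u nb) inE.
    by move=> e eA; exfalso; move: eA; rewrite (AF G u nb) inE.
  have b' : big G' by rewrite -eb.
  have [ek ed] := kept_ext (ltnW j8) pG pG' (es bG).
  apply: And3; first exact: etrans (AT G u bG) (etrans ek (esym (AT G' u b'))).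
    by move=> e /AE; apply: ed.
  by move=> e _; rewrite /mid -ek.
- move=> h w G pG; apply: leq_trans (leq_trans (_ : 32 <= 64) cap64) => //.
  apply: leq_trans (merge_mid_src p0 best_good G h w (ltnW j8)).
  apply/subset_leq_card/subsetP=> e; rewrite inE => /andP[/AE eA em].
  by rewrite inE eA.
- move=> w g G pG; apply: leq_trans (leq_trans (_ : 32 <= 64) cap64) => //.
  apply: leq_trans (merge_mid_dst p0 best_good G w g j8).
  apply/subset_leq_card/subsetP=> e /bigcupP[h _]; rewrite inE => /and3P[/AE eA em ed].
  apply/bigcupP; exists h => //; rewrite inE eA -/(mid G h e) em /=.
  by rewrite -dstE // (kept_edge eA).
- by move=> G _; apply: kept_cost.
Qed.

Definition view_final u G G' :=
  [/\ big G = big G', small_known u G G'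
    & big G -> u = p0 -> [set deco G e | e in alive G 9] = [set deco G' e | e in alive G' 9]].

Lemma know_final T : computable c K T (view_items 8) -> computable c K T.+2 view_final.
Proof.
move=> cj; pose A G h := if big G then kept G 8 h else set0.
pose mid G (h : 'I_n) e : 'I_n := insubd p0 (final_mid (kept G 8 h) h e).
pose dst (x : item) : 'I_n := p0.
have AT G h : big G -> A G h = kept G 8 h by rewrite /A => ->.
have AF G h : ~~ big G -> A G h = set0 by rewrite /A => /negPf->.
have AE G h e : e \in A G h -> e \in kept G 8 h by rewrite /A; case: ifP; rewrite ?inE.
have := @computable_route c n K T _ _ item cap (c + 8) A deco mid dst K_ge card_item.
move=> /(_ _ _ _ _ _ cj) step; apply: computable_weaken (step _ _ _ _).
- move=> u G G' pG pG' [[eb sk _] es]; apply: (And3 eb sk) => bG up.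
  have setE G1 : big G1 -> [set deco G1 e | e in \bigcup_v A G1 v & dst (deco G1 e) == u]
      = [set deco G1 e | e in alive G1 9].
    move=> b1; have -> : alive G1 9 = \bigcup_v A G1 v.
      by rewrite /alive aliveS; apply: eq_bigr => v _; rewrite /A b1.
    by apply: eq_imset_pred => e; rewrite !inE /dst up eqxx andbT.
  have b' : big G' by rewrite -eb.
  exact: etrans (esym (setE G bG)) (etrans es (setE G' b')).
- move=> u G G' pG pG' [eb _ es]; have [bG|nb] := boolP (big G); last first.
    have nb' : ~~ big G' by rewrite -eb.
    apply: And3; first exact: etrans (AF G u nb) (esym (AF G' u nb')).
      by move=> e eA; exfalso; move: eA; rewrite (AF G u nb) inE.
    by move=> e eA; exfalso; move: eA; rewrite (AF G u nb) inE.
  have b' : big G' by rewrite -eb.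
  have [ek ed] := kept_ext (leqnn 8) pG pG' (es bG).
  apply: And3; first exact: etrans (AT G u bG) (etrans ek (esym (AT G' u b'))).
    by move=> e /AE; apply: ed.
  by move=> e _; rewrite /mid -ek.
- move=> h w G pG; apply: leq_trans cap64.
  apply: leq_trans (final_mid_src p0 best_good G h w).
  apply/subset_leq_card/subsetP=> e; rewrite inE => /andP[/AE eA em].
  by rewrite inE eA.
- move=> w g G pG; apply: leq_trans cap_ge.
  apply: leq_trans (final_mid_dst p0 best_good G w).
  apply/subset_leq_card/subsetP=> e /bigcupP[h _]; rewrite inE => /and3P[/AE eA em _].
  by apply/bigcupP; exists h => //; rewrite inE eA.
- by move=> G _; apply: kept_cost.
Qed.

(** Ten rounds of preparation, two for each of the eight merges and two for the delivery to [p0]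
    make 28. *)
Lemma know_all : computable c K 28 view_final.
Proof.
have merged j : j <= 8 -> computable c K (10 + j.*2) (view_items j).
  elim: j => [|j IHj] j8; first exact: know_items.
  by rewrite doubleS !addnS; apply: know_merge => //; apply/IHj/ltnW.
exact: know_final (merged 8 isT).
Qed.

Lemma msf_ext (key1 key2 : 'I_n * 'I_n -> int) (A : edge_set n) :
  {in A, key1 =1 key2} -> msf key1 A = msf key2 A.
Proof.
move=> ek; apply/setP=> e; rewrite [LHS]inE [RHS]inE; case eA: (e \in A) => //=.
congr (~~ conn _ _ _); apply/setP=> f; rewrite !inE; case fA: (f \in A) => //=.
by rewrite !ek.
Qed.

Lemma msf_known G G' : poly G -> poly G' -> view_final p0 G G' ->
  msf (key G) (edges G) = msf (key G') (edges G').
Proof.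
move=> pG pG' [eb sk es]; have [bG|nb] := boolP (big G); last first.
  have eG v : wt G v = wt G' v by apply: sk.
  have -> : edges G = edges G' by apply/setP=> e; rewrite !inE eG.
  by apply: msf_ext => e _; rewrite /key eG.
have aE G1 : {subset alive G1 9 <= edges G1} by move=> e; apply: alive_edge.
have [ea ed] := deco_set_inj pG pG' (aE G) (aE G') (es bG erefl).
have restr G1 : msf (key G1) (edges G1) = msf (key G1) (alive G1 9).
  by apply/esym/msf_restrict; [exact: (msf_alive H best G1 (leqnn 9))|apply/subsetP/aE].
rewrite !restr -ea; apply: msf_ext => e eA.
have eA' : e \in edges G' by apply: aE; rewrite -ea.
by have [] := deco_inj pG pG' (aE _ _ eA) eA' (ed e eA).
Qed.

End Algorithm.

Lemma exists_protocol (c : nat) : exists K : nat, forall n : nat,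
  exists P : protocol n, 0 < n -> exists p : 'I_n, forall G : wgraph n, poly_weights c G ->
  [/\ congested_clique P G K 28, output (run P G 28 p) = msf (key G) (edges G),
      forall v, v != p -> output (run P G 28 v) = set0
    & communication P G 28 <= 28 * K * #|edges G|].
Proof.
(* A message carries at most [256 * 64] items, the load of the final delivery, and an item takes at
   most [(c + 8).+1] times [up_log 2 n] bits. *)
exists (256 * 64 * (c + 8).+1) => n; set K := _ * _.
have [n0|n0] := posnP n.
  exists (@Protocol n unit (fun _ _ => tt) (fun _ _ => [::]) (fun _ _ => tt) (fun _ => set0)).
  by rewrite n0.
have [H HH] := hitting_family n.
have ca := know_all n0 HH (leqnn _) (leqnn K).
have [P PP] := computable_protocol (F := fun G => msf (key G) (edges G)) (p := Ordinal n0) ca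
  (fun G G' pG pG' => msf_known pG pG').
by exists P => _; exists (Ordinal n0).
Qed.

Theorem theorem1 :
  forall c : nat,
  exists (T D K : nat) (Q P : forall n : nat, protocol n),
  forall n : nat, 0 < n ->
  exists (p : 'I_n) (dec : state (Q n) -> state (P n)),
  forall G : wgraph n, poly_weights c G ->
  [/\ congested_clique (Q n) G K (D * T),
      solves_msf (Q n) G (D * T) p,
      implements dec D T G,
      routed (P n) G K T
    & communication (P n) G T <= K * #|edges G|].
Proof.
move=> c; have [K exP] := exists_protocol c.
pose P n := projT1 (cid (exP n)); have PP n := projT2 (cid (exP n)).
(* All routing is already explicit, so [P] is its own implementation with one round per round. The
   constant covers the messages of all 28 rounds, and the successor makes it positive for the bound
   [K * n] on the load. *)
exists 28, 1, (28 * K).+1, P, P => n n0; have [p Pp] := PP n n0.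
exists p, id => G /Pp[[len one] outp out0 cost]; rewrite mul1n.
have len' : log_messages (P n) G (28 * K).+1 28.
  move=> t u v msg tT /(len t u v msg tT) le; apply: leq_trans le _.
  by rewrite leq_mul2r leqW ?leq_pmull ?orbT.
split=> //.
- split=> [|v]; first by rewrite outp; apply: msf_minimum.
  by have [->|vp] := eqVneq v p; rewrite // (out0 v vp) sub0set.
- by split=> [t v _|v]; rewrite mul1n.
- split=> // t v tT; split.
    apply: (@leq_trans (\sum_(w < n) 1)); first by apply: leq_sum => w _; apply: one.
    by rewrite sum1_card card_ord leq_pmull.
  apply: (@leq_trans (\sum_(w < n) 1)); first by apply: leq_sum => w _; apply: one.
  by rewrite sum1_card card_ord leq_pmull.
- by apply: leq_trans cost _; rewrite leq_mul2r leqnSn orbT.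
Qed.
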